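(* Let $\alpha\in(0,1)$ be a fixed constant and assume that the kernels satisfy $0\le k^j(x,x')\le K^j$ for all $x,x'\in\mathbb X^j$ and $j\in[d]$. Then the dpdHSIC test $\phi_{\mathrm{dpdHSIC}}$ (defined in the context) satisfies: (i) (Privacy guarantee) For $\epsilon>0$ and $\delta\in[0,1)$, $\phi_{\mathrm{dpdHSIC}}$ is $(\epsilon,\delta)$-differentially private. (ii) (Validity) The type I error is controlled at level $\alpha$ non-asymptotically: for every $n$, $\mathbb E_P[\phi_{\mathrm{dpdHSIC}}]\le\alpha$ for every $P$ with $P=\otimes_{j=1}^dP_{X^j}$. (iii) (Pointwise consistency) Assume that $n^{-1}\xi_{\epsilon,\delta}^{-1}\to0$ as $n\to\infty$. Then for any sequence of numbers of permutations $B=B_n$ with $\min_{n\ge1}B_n>\alpha^{-1}-1$, and for any fixed alternative $P_{X^1,\dots,X^d}\ne\otimes_{j=1}^dP_{X^j}$, $$\lim_{n\to\infty}\mathbb E_{P_{X^1,\dots,X^d}}[\phi_{\mathrm{dpdHSIC}}]=1 .$$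
   Context: Superscripts $j\in[d]=\{1,\dots,d\}$ are indices, not exponents; $d\ge2$ is fixed. For each $j$, $\mathbb X^j$ is a separable topological space and $k^j:\mathbb X^j\times\mathbb X^j\to\mathbb R$ is a continuous, bounded, positive semi-definite kernel with RKHS $\mathcal H^j$ (kernels and bounds $K^j$ do not depend on $n$). The tensor product kernel $\mathbf k((x^j)_j,(x'^j)_j)=\prod_{j=1}^dk^j(x^j,x'^j)$, with RKHS $\mathcal H_{\mathbf k}=\mathcal H^1\otimes\dots\otimes\mathcal H^d$, is assumed characteristic (mean embedding of probability distributions injective). $\mathcal F_{\mathbf k}$ is the unit ball of $\mathcal H_{\mathbf k}$; $K_0=\prod_{j=1}^dK^j$. $\mathcal X_n=(\mathbf X_1,\dots,\mathbf X_n)$, $\mathbf X_i=(X_i^1,\dots,X_i^d)$, is an i.i.d. sample from $P=P_{X^1,\dots,X^d}$ with marginals $P_{X^j}$ on $\mathbb X^j$. Empirical dHSIC: $$\widehat{\mathrm{dHSIC}}(\mathcal X_n)=\sup_{f\in\mathcal F_{\mathbf k}}\Big\{\frac1n\sum_{i=1}^nf(X_i^1,\dots,X_i^d)-\frac1{n^d}\sum_{(i_1,\dots,i_d)\in[n]^d}f(X_{i_1}^1,\dots,X_{i_d}^d)\Big\}.$$ For a $d$-tuple $\boldsymbol\pi=(\pi^1,\dots,\pi^d)$ of permutations of $[n]$, $\mathcal X_n^{\boldsymbol\pi}$ has $i$-th element $(X^1_{\pi^1(i)},\dots,X^d_{\pi^d(i)})$. dpdHSIC test: given $\epsilon>0$,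 $\delta\in[0,1)$ (possibly depending on $n$), $B\ge1$, set $\xi_{\epsilon,\delta}=\epsilon+\log(1/(1-\delta))$ and $\Delta_T=2d\sqrt{K_0}/n$. Let $\boldsymbol\pi_0$ be the identity, $\boldsymbol\pi_1,\dots,\boldsymbol\pi_B$ i.i.d. uniform $d$-tuples of permutations, $\zeta_0,\dots,\zeta_B$ i.i.d. standard Laplace (location $0$, scale $1$), all independent of each other and of the data. Put $M_i=\widehat{\mathrm{dHSIC}}(\mathcal X_n^{\boldsymbol\pi_i})+2\Delta_T\xi_{\epsilon,\delta}^{-1}\zeta_i$, $\hat p_{\mathrm{dp}}=\frac1{B+1}\{\sum_{i=1}^B\mathbb 1(M_i\ge M_0)+1\}$ and $\phi_{\mathrm{dpdHSIC}}=\mathbb 1(\hat p_{\mathrm{dp}}\le\alpha)$. The hypotheses are $H_0:P=\otimes_jP_{X^j}$ versus $H_1:P\ne\otimes_jP_{X^j}$. Differential privacy: a randomized algorithm $\mathcal M$ with auxiliary variable $w$ (here the permutations) is $(\epsilon,\delta)$-DP if for all measurable output sets $S$, all $w$, and all $\mathcal X_n,\tilde{\mathcal X}_n$ differing in at most one $\mathbf X_i$, $\mathbb P(\mathcal M(\mathcal X_n;w)\in S\mid\mathcal X_n,w)\le e^\epsilon\,\mathbb P(\mathcal M(\tilde{\mathcal X}_n;w)\in S\mid\tilde{\mathcal X}_n,w)+\delta$. *)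

(* Defs.v *)
From HB Require Import structures.
From mathcomp Require Import all_boot all_order all_algebra all_fingroup.
From mathcomp Require Import all_classical all_reals all_analysis.

Set Implicit Arguments.
Unset Strict Implicit.
Unset Printing Implicit Defensive.

Import Order.TTheory GRing.Theory Num.Theory.
Import numFieldNormedType.Exports.

Local Open Scope classical_set_scope.
Local Open Scope ring_scope.

Definition psd_kernel (R : realType) (T : Type) (k : T -> T -> R) : Prop :=
  (forall x y, k x y = k y x) /\
  (forall (m : nat) (a : 'I_m -> R) (x : 'I_m -> T),
    0 <= \sum_(i < m) \sum_(l < m) a i * a l * k (x i) (x l)).

(* A Hilbert space of functions on T, [rkhs_fun f] being the function that the
   vector f is, with reproducing kernel k; by the Moore-Aronszajn theorem it
   exists and is unique up to isometry when k is positive semi-definite. *)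
Record rkhs (R : realType) (T : Type) (k : T -> T -> R) := Rkhs {
  rkhs_sort :> completeNormedModType R ;
  rkhs_dot : rkhs_sort -> rkhs_sort -> R ;
  rkhs_dotC : forall f g, rkhs_dot f g = rkhs_dot g f ;
  rkhs_dotDl : forall a f g h,
    rkhs_dot (a *: f + g) h = a * rkhs_dot f h + rkhs_dot g h ;
  rkhs_dot_norm : forall f, rkhs_dot f f = `|f| ^+ 2 ;
  rkhs_fun : rkhs_sort -> T -> R ;
  rkhs_funD : forall a f g x,
    rkhs_fun (a *: f + g) x = a * rkhs_fun f x + rkhs_fun g x ;
  rkhs_fun_inj : injective rkhs_fun ;
  rkhs_section : T -> rkhs_sort ;
  rkhs_sectionE : forall x y, rkhs_fun (rkhs_section x) y = k y x ;
  rkhs_reproducing : forall f x, rkhs_fun f x = rkhs_dot f (rkhs_section x)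
}.

Definition separable (T : topologicalType) : Prop :=
  exists D : set T, countable D /\ dense D.

Definition borel (T : topologicalType) : set (set T) := <<s @open T >>.
Arguments borel T _ : clear implicits.

Definition cylinders (d : nat) (X : 'I_d -> ptopologicalType) :
    set (set (forall j, X j)) :=
  \bigcup_(j in [set: 'I_d])
    preimage_set_system setT (fun x : forall j, X j => x j) (borel (X j)).
Arguments cylinders {d} X _.

(* The product of the spaces X j with the product of their Borel
   sigma-algebras. *)
Notation prod_space X := (g_sigma_algebraType (cylinders X)).

Definition marginal (R : realType) (d : nat) (X : 'I_d -> ptopologicalType)
    (P : probability (prod_space X) R) (j : 'I_d) (A : set (X j)) : \bar R :=
  P [set x : forall l, X l | A (x j)].

(* P is the product of its marginals: the product measure is the only measure
   that factorizes in this way over the measurable rectangles. *)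
Definition product_of_marginals (R : realType) (d : nat)
    (X : 'I_d -> ptopologicalType) (P : probability (prod_space X) R) : Prop :=
  forall A : (forall j, set (X j)), (forall j, borel (X j) (A j)) ->
    P [set x : forall j, X j | forall j, A j (x j)]
      = (\prod_(j < d) marginal P (A j))%E.

Definition tensor_kernel (R : realType) (d : nat) (X : 'I_d -> Type)
    (k : forall j, X j -> X j -> R) (x y : forall j, X j) : R :=
  \prod_(j < d) k j (x j) (y j).

(* The function y |-> E_P[k(X, y)], i.e. the Bochner integral E_P[k(X, .)] seen
   as an element of the RKHS. *)
Definition mean_embedding (R : realType) (dT : measure_display)
    (T : measurableType dT) (k : T -> T -> R) (P : probability T R) (y : T) : R :=
  \int[P]_x k x y.

(* Equality of measures is only meaningful on measurable sets: the library's
   measures are functions on all sets. *)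
Definition characteristic_kernel (R : realType) (dT : measure_display)
    (T : measurableType dT) (k : T -> T -> R) : Prop :=
  forall P Q : probability T R, mean_embedding k P =1 mean_embedding k Q ->
    forall A : set T, measurable A -> P A = Q A.

Section test.
Context (R : realType) (d : nat) (X : 'I_d -> ptopologicalType).
Context (k : forall j, X j -> X j -> R) (H : rkhs (tensor_kernel k)).

Definition dHSIC (n : nat) (x : 'I_n -> prod_space X) : R :=
  sup [set n%:R^-1 * (\sum_(i < n) rkhs_fun f (x i))
         - (n%:R ^+ d)^-1 * (\sum_(s : {ffun 'I_d -> 'I_n})
             rkhs_fun f (fun j => x (s j) j))
      | f in [set f : H | `|f| <= 1]].

Definition permute (n : nat) (x : 'I_n -> prod_space X)
    (p : {ffun 'I_d -> 'S_n}) : 'I_n -> prod_space X :=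
  fun i j => x (p j i) j.

(* Index 0 is the identity, index b + 1 is p b. *)
Definition with_identity (n B : nat) (p : 'I_B -> {ffun 'I_d -> 'S_n})
    (b : 'I_B.+1) : {ffun 'I_d -> 'S_n} :=
  if unlift ord0 b is Some c then p c else [ffun=> 1%g].

Definition privacy_level (eps del : R) : R := eps + ln (1 / (1 - del)).

Definition sensitivity (K : 'I_d -> R) (n : nat) : R :=
  2 * d%:R * Num.sqrt (\prod_(j < d) K j) / n%:R.

Context (K : 'I_d -> R) (alpha eps del : R).

Definition noisy_statistic (n B : nat) (x : 'I_n -> prod_space X)
    (p : 'I_B -> {ffun 'I_d -> 'S_n}) (z : 'I_B.+1 -> R) (b : 'I_B.+1) : R :=
  dHSIC (permute x (with_identity p b))
    + 2 * sensitivity K n * (privacy_level eps del)^-1 * z b.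

Definition dp_pvalue (n B : nat) (x : 'I_n -> prod_space X)
    (p : 'I_B -> {ffun 'I_d -> 'S_n}) (z : 'I_B.+1 -> R) : R :=
  B.+1%:R^-1 * ((\sum_(b < B)
    (noisy_statistic x p z ord0 <= noisy_statistic x p z (lift ord0 b))%R%:R)
    + 1).

Definition dpdHSIC_test (n B : nat) (x : 'I_n -> prod_space X)
    (p : 'I_B -> {ffun 'I_d -> 'S_n}) (z : 'I_B.+1 -> R) : bool :=
  dp_pvalue x p z <= alpha.

End test.

Definition mutually_independent (R : realType) (dO : measure_display)
    (Om : measurableType dO) (Q : probability Om R) (I : finType)
    (F : I -> set (set Om)) : Prop :=
  forall (J : {set I}) (E : I -> set Om), (forall i, i \in J -> F i (E i)) ->
    Q (\bigcap_(i in [set` J]) E i) = (\prod_(i in J) Q (E i))%E.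

(* The sigma-algebra generated by Y, if G is the sigma-algebra of its
   codomain. *)
Definition generated (Om T : Type) (Y : Om -> T) (G : set (set T)) :
    set (set Om) :=
  preimage_set_system setT Y G.

Definition laplace_pdf (R : realType) (x : R) : R := expR (- `|x|) / 2.

Definition laplace_prob (R : realType) (A : set R) : \bar R :=
  (\int[lebesgue_measure]_(x in A) (laplace_pdf x)%:E)%E.

Definition standard_laplace (R : realType) (dO : measure_display)
    (Om : measurableType dO) (Q : probability Om R) (z : {RV Q >-> R}) : Prop :=
  forall A : set R, measurable A -> distribution Q z A = laplace_prob A.

Definition iid_laplace (R : realType) (dO : measure_display)
    (Om : measurableType dO) (Q : probability Om R) (m : nat)
    (z : 'I_m -> {RV Q >-> R}) : Prop :=
  (forall b, standard_laplace (z b)) /\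
  mutually_independent Q (fun b => generated (z b) measurable).

Definition uniform_on_finite (R : realType) (dO : measure_display)
    (Om : measurableType dO) (Q : probability Om R) (T : finType)
    (Y : Om -> T) : Prop :=
  forall t, measurable (Y @^-1` [set t]) /\
            Q (Y @^-1` [set t]) = (#|T|%:R^-1)%:E.

Record dpdHSIC_experiment (R : realType) (d : nat)
    (X : 'I_d -> ptopologicalType) (P : probability (prod_space X) R)
    (dO : measure_display) (Om : measurableType dO) (Q : probability Om R)
    (n B : nat) (x : 'I_n -> {RV Q >-> prod_space X})
    (p : 'I_B -> Om -> {ffun 'I_d -> 'S_n})
    (z : 'I_B.+1 -> {RV Q >-> R}) : Prop := {
  sample_law : forall i (A : set (prod_space X)), measurable A ->
    distribution Q (x i) A = P A ;
  permutation_law : forall b, uniform_on_finite Q (p b) ;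
  noise_law : forall b, standard_laplace (z b) ;
  all_independent : mutually_independent Q
    (fun s : 'I_n + 'I_B + 'I_B.+1 =>
       match s with
       | inl (inl i) => generated (x i) measurable
       | inl (inr b) => generated (p b) setT
       | inr b => generated (z b) measurable
       end)
}.

Definition expected_test (R : realType) (d : nat) (X : 'I_d -> ptopologicalType)
    (k : forall j, X j -> X j -> R) (H : rkhs (tensor_kernel k))
    (K : 'I_d -> R) (alpha eps del : R)
    (dO : measure_display) (Om : measurableType dO) (Q : probability Om R)
    (n B : nat) (x : 'I_n -> {RV Q >-> prod_space X})
    (p : 'I_B -> Om -> {ffun 'I_d -> 'S_n})
    (z : 'I_B.+1 -> {RV Q >-> R}) : \bar R :=
  'E_Q[fun om => (dpdHSIC_test H K alpha eps del
                   (fun i => x i om) (p ^~ om) (z ^~ om))%:R].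

Definition neighbours (T : Type) (n : nat) (x y : 'I_n -> T) : Prop :=
  exists i, forall l, l != i -> x l = y l.

(* The probability space Q carries the internal randomness of the mechanism M,
   whose arguments are the data set and the auxiliary variable. *)
Definition differentially_private (R : realType) (eps del : R) (T W : Type)
    (n : nat) (dO : measure_display) (Om : measurableType dO)
    (Q : probability Om R) (dV : measure_display) (V : measurableType dV)
    (M : ('I_n -> T) -> W -> Om -> V) : Prop :=
  forall (S : set V) (w : W) (x y : 'I_n -> T),
    measurable S -> neighbours x y ->
    (Q (M x w @^-1` S) <= (expR eps)%:E * Q (M y w @^-1` S) + del%:E)%E.

(* Main.v *)
Require Import Defs.
From HB Require Import structures.
From mathcomp Require Import all_boot all_order all_algebra all_fingroup.
From mathcomp Require Import all_classical all_reals all_analysis.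
From mathcomp Require Import measurable_realfun.
From mathcomp Require Import ring lra.

Set Implicit Arguments.
Unset Strict Implicit.
Unset Printing Implicit Defensive.

Import Order.TTheory GRing.Theory Num.Theory.
Import numFieldNormedType.Exports.

Local Open Scope classical_set_scope.
Local Open Scope ring_scope.

(** The supremum of a linear functional over the unit ball of a Hilbert space is
    the norm of its representer.  Hence the statistic of a sample is the
    distance between two elements of the RKHS: the mean of the kernel sections
    at the observations, and the mean of the sections at all recombinations of
    their coordinates ([dHSICE]).  Its square is a polynomial in the values
    [k j (x a j) (x b j)], and the rest of the proof works with this polynomial
    or with inner products.

    Privacy.  A change of one record is a succession of [d] changes of one
    coordinate in one row, and this remains so after a permutation of each
    column.  One such change moves the statistic by at most
    [2 * sqrt K0 / n] ([dHSIC_change_coordinate]), because the kernels are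
    nonnegative; so the sensitivity is [sensitivity K n].  Raising the noise of
    index 0 by the privacy level therefore compensates for a change of one
    record in all the comparisons of the p-value at once
    ([dpdHSIC_test_shift]), and raising a standard Laplace variable by [c]
    changes probabilities by a factor at most [exp |c|]
    ([laplace_prob_shift], [prob_shift_first]).  The extra
    [ln (1 / (1 - del))] in the privacy level is traded for the additive [del].

    Validity.  Under independence of the coordinates the law of the sample is
    invariant under a permutation of each column, and the noise is exchangeable
    ([null_rearrangement]).  Composing with a common random tuple of
    permutations makes the identity as random as the other tuples, so that all
    [B + 1] noisy statistics play the same role, and at most
    [alpha * (B + 1)] of them can have a p-value at most [alpha]
    ([sum_rank_pvalue_le]).

    Consistency.  The number of exceedances that leads to acceptance is a
    positive fraction of [B], uniformly in [B], so by Markov's inequality it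
    suffices that a single exceedance be improbable
    ([type_two_error_bound]).  The permuted statistics tend to 0: for a fixed
    data set the second moment over the permutations is of order [1 / n]
    ([sum_sqr_dHSIC_permute]).  The scaled noise tends to 0 because [n] times
    the privacy level tends to infinity.  The observed statistic stays away
    from 0: the kernel being characteristic, a single section of it separates
    the joint law from the product of its marginals
    ([alternative_separated]), the statistic dominates the difference of the
    two empirical means of that section, and laws of large numbers apply, the
    second mean being a product of one average per coordinate
    ([prob_observed_small]).

    All events have to be measurable for the product of the Borel
    sigma-algebras, which on separable spaces follows from the continuity and
    the positive semi-definiteness of the kernels ([measurable_psd_kernel]). *)

(** * The statistic as a norm in the Hilbert space *)

Section hilbert.
Context (R : realType) (T : Type) (k : T -> T -> R) (H : rkhs k).
Implicit Types f g h : H.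
Local Notation dot := (@rkhs_dot R T k H).
Local Notation sec := (@rkhs_section R T k H).

Lemma dotDl f g h : dot (f + g) h = dot f h + dot g h.
Proof. by rewrite -{1}[f]scale1r rkhs_dotDl mul1r. Qed.

Lemma dot0l h : dot 0 h = 0.
Proof. by apply: (addrI (dot 0 h)); rewrite -dotDl !addr0. Qed.

Lemma dotZl a f h : dot (a *: f) h = a * dot f h.
Proof. by rewrite -[a *: f]addr0 rkhs_dotDl dot0l addr0. Qed.

Lemma dotNl f h : dot (- f) h = - dot f h.
Proof. by rewrite -scaleN1r dotZl mulN1r. Qed.

Lemma dotBl f g h : dot (f - g) h = dot f h - dot g h.
Proof. by rewrite dotDl dotNl. Qed.

Lemma dot_suml I (r : seq I) (p : pred I) (F : I -> H) h :
  dot (\sum_(i <- r | p i) F i) h = \sum_(i <- r | p i) dot (F i) h.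
Proof.
by apply: (big_morph (fun f => dot f h)) => [f g|]; [exact: dotDl|exact: dot0l].
Qed.

Lemma dotZr a f h : dot h (a *: f) = a * dot h f.
Proof. by rewrite rkhs_dotC dotZl rkhs_dotC. Qed.

Lemma dotBr f g h : dot h (f - g) = dot h f - dot h g.
Proof. by rewrite rkhs_dotC dotBl !(rkhs_dotC _ h). Qed.

Lemma dot_sumr I (r : seq I) (p : pred I) (F : I -> H) h :
  dot h (\sum_(i <- r | p i) F i) = \sum_(i <- r | p i) dot h (F i).
Proof. by rewrite rkhs_dotC dot_suml; apply: eq_bigr => i _; rewrite rkhs_dotC. Qed.

Lemma dot_section x y : dot (sec x) (sec y) = k x y.
Proof. by rewrite rkhs_dotC -rkhs_reproducing rkhs_sectionE. Qed.

Lemma sqr_normB f g : `|f - g| ^+ 2 = `|f| ^+ 2 - 2 * dot f g + `|g| ^+ 2.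
Proof. by rewrite -!rkhs_dot_norm dotBl !dotBr (rkhs_dotC g f); ring. Qed.

Lemma dot_le_norm f g : dot f g <= `|f| * `|g|.
Proof.
have [->|g0] := eqVneq g 0.
  by rewrite rkhs_dotC dot0l normr0 mulr0.
have [->|f0] := eqVneq f 0.
  by rewrite dot0l normr0 mul0r.
have nf : 0 < `|f| by rewrite normr_gt0.
have ng : 0 < `|g| by rewrite normr_gt0.
have := sqr_ge0 `| `|g| *: f - `|f| *: g |.
rewrite sqr_normB dotZl dotZr !normrZ !normr_id.
rewrite [X in 0 <= X](_ : _ = 2 * (`|f| * `|g|) * (`|f| * `|g| - dot f g)); last by ring.
by rewrite pmulr_rge0 ?mulr_gt0// subr_ge0.
Qed.

(** The norm is attained on the unit ball at the normalized vector, which is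
    what turns a supremum over the ball into a finite expression in the
    kernel. *)
Lemma sup_unit_ball f : sup [set dot h f | h in [set h : H | `|h| <= 1]] = `|f|.
Proof.
have ub : ubound [set dot h f | h in [set h : H | `|h| <= 1]] `|f|.
  move=> _ [h /= h1 <-]; apply: (le_trans (dot_le_norm _ _)).
  by rewrite -[leRHS]mul1r ler_wpM2r.
apply/eqP; rewrite eq_le; apply/andP; split.
  apply: ge_sup => //; exists (dot 0 f); exists 0 => //=.
  by rewrite normr0.
apply: sup_upper_bound; first by split; [exists (dot 0 f); exists 0; rewrite //= normr0|exists `|f|].
have [->|f0] := eqVneq f 0.
  by exists 0; rewrite /= ?dot0l ?normr0.
exists (`|f|^-1 *: f) => /=.
  by rewrite normrZ normfV normr_id mulVf// normr_eq0.
by rewrite dotZl rkhs_dot_norm expr2 mulrA mulVf ?mul1r// normr_eq0.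
Qed.

End hilbert.

Section dhsic_vector.
Context (R : realType) (d : nat) (X : 'I_d -> ptopologicalType).
Context (k : forall j, X j -> X j -> R) (H : rkhs (tensor_kernel k)).
Local Notation dot := (@rkhs_dot R _ _ H).
Local Notation sec := (@rkhs_section R _ _ H).

Definition recombine n (x : 'I_n -> prod_space X) (s : {ffun 'I_d -> 'I_n}) :
  forall j, X j := fun j => x (s j) j.

Definition joint_mean n (x : 'I_n -> prod_space X) : H :=
  n%:R^-1 *: \sum_(i < n) sec (x i).

Definition product_mean n (x : 'I_n -> prod_space X) : H :=
  (n%:R ^+ d)^-1 *: \sum_(s : {ffun 'I_d -> 'I_n}) sec (recombine x s).

(** The quantity whose supremum over the unit ball is the statistic. *)
Definition witness_value n (x : 'I_n -> prod_space X) (f : H) : R :=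
  n%:R^-1 * (\sum_(i < n) rkhs_fun f (x i))
         - (n%:R ^+ d)^-1 * (\sum_(s : {ffun 'I_d -> 'I_n})
             rkhs_fun f (recombine x s)).

Lemma witness_valueE n (x : 'I_n -> prod_space X) f :
  witness_value x f = dot f (joint_mean x - product_mean x).
Proof.
rewrite dotBr !dotZr !dot_sumr; congr (_ * _ - _ * _);
  by apply: eq_bigr => i _; rewrite rkhs_reproducing.
Qed.

Lemma dHSICE n (x : 'I_n -> prod_space X) :
  dHSIC H x = `|joint_mean x - product_mean x|.
Proof.
rewrite -sup_unit_ball /dHSIC; congr (sup _); apply: eq_imagel => f _.
exact: witness_valueE.
Qed.

End dhsic_vector.

Lemma permute_identity (d : nat) (X : 'I_d -> ptopologicalType) n
    (u : 'I_n -> prod_space X) : permute u [ffun=> 1%g] = u.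
Proof.
apply/funext => i; apply: functional_extensionality_dep => j.
by rewrite /permute ffunE perm1.
Qed.

Definition compose_perms (n d : nat) (sigma rho : {ffun 'I_d -> 'S_n}) :
  {ffun 'I_d -> 'S_n} := [ffun j => (rho j * sigma j)%g].

Lemma permute_compose (d : nat) (X : 'I_d -> ptopologicalType) n
    (u : 'I_n -> prod_space X) (sigma rho : {ffun 'I_d -> 'S_n}) :
  permute (permute u sigma) rho = permute u (compose_perms sigma rho).
Proof.
apply/funext => i; apply: functional_extensionality_dep => j.
by rewrite /permute ffunE permM.
Qed.

(** * Deterministic bounds: sensitivity and second moment over the permutations *)

Section permutation_sums.
Context (R : realType) (n : nat).

(** By transitivity the left-hand sum does not depend on the index; average it
    over all indices. *)
Lemma sum_perm_point (F : 'I_n -> R) (i : 'I_n) :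
  n%:R * \sum_(s : 'S_n) F (s i) = #|{: 'S_n}|%:R * \sum_a F a.
Proof.
have same i' : \sum_(s : 'S_n) F (s i) = \sum_(s : 'S_n) F (s i').
  rewrite (reindex_inj (mulgI (tperm i i'))) /=.
  by apply: eq_bigr => s _; rewrite permM tpermL.
have <- : \sum_(i' < n) \sum_(s : 'S_n) F (s i) = n%:R * \sum_(s : 'S_n) F (s i).
  by rewrite sumr_const card_ord mulr_natl.
under eq_bigr => i' _ do rewrite (same i').
rewrite exchange_big /= (eq_bigr (fun=> \sum_a F a)) => [|s _].
  by rewrite sumr_const mulr_natl.
by rewrite [RHS](reindex_inj (@perm_inj _ s)).
Qed.

Lemma perm_transport (i i' a b : 'I_n) : i != i' -> a != b ->
  exists s : 'S_n, s i = a /\ s i' = b.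
Proof.
move=> ii' ab; exists (tperm i a * tperm (tperm i a i') b)%g.
split; last by rewrite permM tpermL.
have ia : a != tperm i a i' by rewrite -{1}(tpermL i a) (inj_eq perm_inj).
by rewrite permM tpermL; apply: tpermD; rewrite eq_sym.
Qed.

(** The symmetric group is transitive on pairs of distinct indices, so a uniform
    permutation maps any such pair to a uniform one. *)
Lemma sum_perm_pair (F : 'I_n -> 'I_n -> R) (i i' : 'I_n) : i != i' ->
  (n * n.-1)%:R * \sum_(s : 'S_n) F (s i) (s i')
    = #|{: 'S_n}|%:R * \sum_a \sum_(b | b != a) F a b.
Proof.
move=> ii'.
have same (a b : 'I_n) : a != b ->
    \sum_(s : 'S_n) F (s a) (s b) = \sum_(s : 'S_n) F (s i) (s i').
  move=> ab; have [t [ti ti']] := perm_transport ii' ab.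
  rewrite [RHS](reindex_inj (mulgI t)) /=.
  by apply: eq_bigr => s _; rewrite !permM ti ti'.
transitivity (\sum_(a < n) \sum_(b < n | b != a) \sum_(s : 'S_n) F (s a) (s b)).
  rewrite [RHS](eq_bigr (fun=> (\sum_(s : 'S_n) F (s i) (s i')) *+ n.-1)) => [|a _].
    by rewrite sumr_const card_ord -mulrnA mulnC mulr_natl.
  rewrite (eq_bigr (fun=> \sum_(s : 'S_n) F (s i) (s i'))) => [|b ba].
    by rewrite sumr_const cardC1 card_ord.
  by rewrite same // eq_sym.
under eq_bigr do rewrite exchange_big /=.
rewrite exchange_big /= (eq_bigr (fun=> \sum_a \sum_(b | b != a) F a b)) => [|s _].
  by rewrite sumr_const mulr_natl.
rewrite [RHS](reindex_inj (@perm_inj _ s)) /=.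
apply: eq_bigr => a _; rewrite [RHS](reindex_inj (@perm_inj _ s)) /=.
by apply: eq_bigl => b; rewrite (inj_eq perm_inj).
Qed.

End permutation_sums.

Section dhsic_bounds.
Context (R : realType) (d : nat) (X : 'I_d -> ptopologicalType).
Context (k : forall j, X j -> X j -> R).
Arguments k : clear implicits.
Context (H : rkhs (tensor_kernel k)).
Context (k_psd : forall j, psd_kernel (k j)).
Context (K : 'I_d -> R) (k_bounds : forall j x y, 0 <= k j x y <= K j).
Local Notation dot := (@rkhs_dot R _ _ H).
Local Notation sec := (@rkhs_section R _ _ H).
Local Notation K0 := (\prod_(j < d) K j).

Lemma kernel_ge0 j a b : 0 <= k j a b.
Proof. by case/andP: (k_bounds a b). Qed.

Lemma kernel_leK j a b : k j a b <= K j.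
Proof. by case/andP: (k_bounds a b). Qed.

Lemma bound_ge0 j : 0 <= K j.
Proof. exact: le_trans (@kernel_ge0 j point point) (@kernel_leK j point point). Qed.

Lemma prod_bound_ge0 : 0 <= K0.
Proof. by apply: prodr_ge0 => j _; exact: bound_ge0. Qed.

Lemma psd_kernel_sqdist_ge0 (T : Type) (h : T -> T -> R) a b :
  psd_kernel h -> 0 <= h a a - h a b - h b a + h b b.
Proof.
move=> [_ /(_ 2%N (fun i => if i == ord0 then 1 else -1)
                  (fun i => if i == ord0 then a else b))].
rewrite !big_ord_recl !big_ord0 /= => h0.
by apply: le_trans h0 _; lra.
Qed.

(** The cross term of the squared norm has the favourable sign and is dropped. *)
Lemma sqr_norm_average_gap (I : finType) (A : pred I) (u : I -> H) (u0 : H)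
    (c0 c D : R) : 0 <= c0 -> 0 <= c ->
    dot u0 u0 <= D -> (forall s, A s -> 0 <= dot u0 (u s)) ->
    (forall s t, A s -> A t -> dot (u s) (u t) <= D) ->
  `|c0 *: u0 - c *: \sum_(s | A s) u s| ^+ 2 <= (c0 ^+ 2 + (c * #|A|%:R) ^+ 2) * D.
Proof.
move=> c00 c_0 u0D u0u uD.
rewrite sqr_normB -!rkhs_dot_norm !dotZl !dotZr dot_sumr dot_suml.
under [X in _ + c * (c * X)]eq_bigr do rewrite dot_sumr.
have h1 : 0 <= \sum_(i | A i) dot u0 (u i) by apply: sumr_ge0.
have h2 : \sum_(i | A i) \sum_(j | A j) dot (u i) (u j) <= #|A|%:R ^+ 2 * D.
  apply: (@le_trans _ _ (\sum_(i | A i) \sum_(j | A j) D)).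
    by apply: ler_sum => s As; apply: ler_sum => t At; exact: uD.
  by rewrite !sumr_const -mulrnA -[leLHS]mulr_natl natrM expr2.
have h3 := ler_wpM2l (sqr_ge0 c) h2.
have h4 := ler_wpM2l (sqr_ge0 c0) u0D.
have h5 := mulr_ge0 (mulr_ge0 c00 c_0) h1.
move: h3 h4 h5; rewrite !expr2; lra.
Qed.

Lemma card_fixed_coordinate n (i0 : 'I_n) (j0 : 'I_d) :
  (#|[pred s : {ffun 'I_d -> 'I_n} | s j0 == i0]| * n = n ^ d)%N.
Proof.
pose F j : pred 'I_n := if j == j0 then pred1 i0 else predT.
have -> : #|[pred s : {ffun 'I_d -> 'I_n} | s j0 == i0]| = #|family F|.
  apply: eq_card => s; rewrite !inE; apply/idP/familyP => [/eqP si j|/(_ j0)].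
    by rewrite /F; case: eqVneq => [->|//]; rewrite inE si.
  by rewrite /F eqxx inE.
rewrite card_family foldrE big_map big_enum /=.
rewrite (bigD1 j0)//= /F eqxx card1 mul1n.
rewrite -[in RHS](card_ord d) -prod_nat_const [RHS](bigD1 j0)//= mulnC; congr (_ * _)%N.
by apply: eq_bigr => j /negPf ->; rewrite cardT size_enum_ord.
Qed.

Section one_coordinate.
Context (n : nat) (x x' : 'I_n -> prod_space X) (i0 : 'I_n) (j0 : 'I_d).
Hypothesis xx' : forall i j, (i, j) != (i0, j0) -> x i j = x' i j.

Let u (s : {ffun 'I_d -> 'I_n}) : H := sec (recombine x s) - sec (recombine x' s).

Let diff_outside (s : {ffun 'I_d -> 'I_n}) : s j0 != i0 -> u s = 0.
Proof.
move=> sj; rewrite /u; suff -> : recombine x s = recombine x' s by rewrite subrr.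
apply: functional_extensionality_dep => j; apply: xx'; rewrite xpair_eqE.
by case: eqVneq => //= si; apply: contra sj => /eqP <-; apply/eqP.
Qed.

Let diff_bounds (s t : {ffun 'I_d -> 'I_n}) : s j0 = i0 -> t j0 = i0 -> 0 <= dot (u s) (u t) <= 2 * K0.
Proof.
move=> si ti.
pose c := \prod_(j < d | j != j0) k j (x (s j) j) (x (t j) j).
(* Only the factor of index [j0] distinguishes the four kernel values. *)
have kE (y y' : 'I_n -> prod_space X) (a b : X j0) :
    (forall i j, j != j0 -> y i j = x i j) -> (forall i j, j != j0 -> y' i j = x i j) ->
    y i0 j0 = a -> y' i0 j0 = b ->
    tensor_kernel k (recombine y s) (recombine y' t) = k j0 a b * c.
  move=> hy hy' <- <-; rewrite /tensor_kernel (bigD1 j0)//= /recombine si ti.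
  by congr (_ * _); apply: eq_bigr => j jj0; rewrite hy// hy'.
have hx i j : j != j0 -> x' i j = x i j.
  by move=> jj0; rewrite xx'// xpair_eqE (negPf jj0) andbF.
rewrite /u dotBl !dotBr !dot_section.
rewrite (kE x x _ _ _ _ erefl erefl)// (kE x x' _ _ _ _ erefl erefl)//.
rewrite (kE x' x _ _ _ _ erefl erefl)// (kE x' x' _ _ _ _ erefl erefl)//.
set a := x i0 j0; set b := x' i0 j0.
have c0 : 0 <= c by apply: prodr_ge0 => j _; exact: kernel_ge0.
have cK : c <= \prod_(j < d | j != j0) K j.
  by apply: ler_prod => j _; rewrite kernel_ge0 kernel_leK.
have h0 := psd_kernel_sqdist_ge0 a b (k_psd j0).
have h1 : k j0 a a - k j0 a b - k j0 b a + k j0 b b <= 2 * K j0.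
  have := kernel_ge0 a b; have := kernel_ge0 b a.
  have := kernel_leK a a; have := kernel_leK b b; lra.
rewrite [X in 0 <= X <= _](_ : _ = (k j0 a a - k j0 a b - k j0 b a + k j0 b b) * c); last by ring.
rewrite mulr_ge0//= (bigD1 j0)//= mulrA ler_pM//.
Qed.

(** Both copies of the changed coordinate enter the two means only through the
    vectors [u s] with [s j0 = i0], whose pairwise inner products are
    nonnegative because the kernels are; dropping the cross term of the squared
    norm then saves a factor 2 over the triangle inequality. *)
Lemma dHSIC_change_coordinate :
  dHSIC H x <= dHSIC H x' + 2 * Num.sqrt K0 / n%:R.
Proof.
have n0 : 0 < n%:R :> R by rewrite ltr0n; case: {+}n i0 => [[]|].
rewrite !dHSICE -lerBlDl; apply: (le_trans (lerB_dist _ _)).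
pose c0 : {ffun 'I_d -> 'I_n} := [ffun=> i0].
have recc y i : recombine y [ffun=> i] = y i :> (forall j, X j).
  by apply: functional_extensionality_dep => j; rewrite /recombine ffunE.
have -> : joint_mean H x - product_mean H x - (joint_mean H x' - product_mean H x')
    = n%:R^-1 *: u c0 - (n%:R ^+ d)^-1 *: \sum_(s : {ffun 'I_d -> 'I_n} | s j0 == i0) u s.
  have regroup (a b c e : H) : a - b - (c - e) = a - c - (b - e).
    by rewrite !opprB addrACA [RHS]addrACA; congr (_ + _); exact: addrC.
  rewrite regroup -!scalerBr -!sumrB; congr (_ *: _ - _ *: _).
    rewrite (bigD1 i0)//= big1 ?addr0 ?/u ?recc// => i ii0.
    by have := @diff_outside [ffun=> i]; rewrite /u !recc ffunE => ->.
  by rewrite [LHS](bigID (fun s : {ffun _ -> _} => s j0 == i0)) /= [X in _ + X]big1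
       ?addr0// => s; exact: diff_outside.
have c0i : c0 j0 = i0 by rewrite ffunE.
rewrite -ler_sqr ?nnegrE ?divr_ge0 ?mulr_ge0 ?sqrtr_ge0 ?ler0n//.
apply: (le_trans (@sqr_norm_average_gap {ffun 'I_d -> 'I_n}
    [pred s : {ffun _ -> _} | s j0 == i0] u (u c0) _ _ (2 * K0) _ _ _ _ _)).
- by rewrite invr_ge0 ltW.
- by rewrite invr_ge0 exprn_ge0// ltW.
- by case/andP: (diff_bounds c0i c0i).
- by move=> s /eqP si; case/andP: (diff_bounds c0i si).
- by move=> s t /eqP si /eqP ti; case/andP: (diff_bounds si ti).
have cardE : (n%:R ^+ d)^-1 * #|[pred s : {ffun 'I_d -> 'I_n} | s j0 == i0]|%:R
    = n%:R^-1 :> R.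
  have := card_fixed_coordinate i0 j0.
  move=> /(congr1 (fun m => m%:R : R)); rewrite natrM natrX => <-.
  by rewrite invfM mulrAC mulVf ?mul1r// gt_eqF// -(pmulr_lgt0 _ n0) -natrM
    card_fixed_coordinate natrX exprn_gt0.
rewrite cardE !exprMn sqr_sqrtr ?prod_bound_ge0// le_eqVlt; apply/orP; left.
by apply/eqP; ring.
Qed.

End one_coordinate.

(** Passing from [x] to [y] one coordinate of the changed record at a time keeps
    each permuted sample one coordinate away from the previous one, since a
    permutation moves the changed entry of column [j] to a single row. *)
Lemma dHSIC_sensitivity n (x y : 'I_n -> prod_space X)
    (p : {ffun 'I_d -> 'S_n}) : neighbours x y ->
  dHSIC H (permute x p) <= dHSIC H (permute y p) + sensitivity K n.
Proof.
move=> [i0 xy].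
pose h m : 'I_n -> prod_space X := fun i j => if (j < m)%N then x i j else y i j.
have step m : (m <= d)%N -> dHSIC H (permute (h m) p)
    <= dHSIC H (permute y p) + m%:R * (2 * Num.sqrt K0 / n%:R).
  elim: m => [|m IH] md.
    by rewrite mul0r addr0 le_eqVlt; apply/orP; left; apply/eqP.
  rewrite -natr1 mulrDl mul1r addrA.
  apply: le_trans (lerD (IH (ltnW md)) (lexx _)).
  apply: (@dHSIC_change_coordinate _ _ _ ((p (Ordinal md))^-1%g i0) (Ordinal md)).
  move=> i j; rewrite xpair_eqE negb_and /permute /h => /orP ij.
  rewrite ltnS leq_eqVlt; case: eqVneq => //= jm; rewrite jm ltnn xy//.
  have jE : j = Ordinal md by apply: val_inj.
  by case: ij; rewrite jE ?eqxx//; apply: contra => /eqP <-; rewrite permK.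
have -> : permute x p = permute (h d) p.
  by apply: functional_extensionality_dep => i; apply: functional_extensionality_dep => j; rewrite /permute /h ltn_ord.
apply: le_trans (step d (leqnn d)) _; rewrite lerD2l /sensitivity.
by rewrite le_eqVlt; apply/orP; left; apply/eqP; ring.
Qed.

Section permuted_second_moment.
Context (n : nat) (x : 'I_n -> prod_space X) (n2 : (2 <= n)%N).

Let N : R := #|{: 'S_n}|%:R.
Let psi j a b := k j (x a j) (x b j).
Let G j := \sum_a \sum_b psi j a b.

Let n0 : 0 < n%:R :> R. Proof. by rewrite ltr0n (leq_trans _ n2). Qed.
Let n10 : 0 < n.-1%:R :> R. Proof. by rewrite ltr0n -ltnS prednK// (leq_trans _ n2). Qed.
Let psi_ge0 j a b : 0 <= psi j a b. Proof. exact: kernel_ge0. Qed.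
Let N_ge0 : 0 <= N. Proof. by rewrite ler0n. Qed.

Let card_tuples : #|{ffun 'I_d -> 'S_n}|%:R = N ^+ d.
Proof. by rewrite card_ffun card_ord natrX. Qed.

Let sum_tuples (F : 'I_d -> 'S_n -> R) :
  \sum_(p : {ffun 'I_d -> 'S_n}) \prod_j F j (p j) = \prod_j \sum_s F j s.
Proof. by rewrite bigA_distr_bigA. Qed.

Let sum_indices (F : 'I_d -> 'I_n -> R) :
  \sum_(s : {ffun 'I_d -> 'I_n}) \prod_j F j (s j) = \prod_j \sum_a F j a.
Proof. by rewrite bigA_distr_bigA. Qed.

Let product_mean_permute p : product_mean H (permute x p) = product_mean H x.
Proof.
rewrite /product_mean; congr (_ *: _).
pose f (s : {ffun 'I_d -> 'I_n}) : {ffun 'I_d -> 'I_n} := [ffun j => p j (s j)].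
have fI : injective f.
  by move=> s t /ffunP st; apply/ffunP => j; have := st j; rewrite !ffunE => /perm_inj.
rewrite [RHS](reindex_inj fI) /=; apply: eq_bigr => s _; congr (sec _).
by apply: functional_extensionality_dep => j; rewrite /recombine /permute ffunE.
Qed.

Let product_mean_sqr :
  dot (product_mean H x) (product_mean H x) = (n%:R ^+ d)^-1 ^+ 2 * \prod_j G j.
Proof.
rewrite /product_mean dotZl dotZr mulrA -expr2; congr (_ * _).
rewrite dot_suml /G -sum_indices; apply: eq_bigr => s _.
by rewrite dot_sumr -sum_indices; apply: eq_bigr => t _; rewrite dot_section.
Qed.

Let cross_term :
  \sum_(p : {ffun 'I_d -> 'S_n}) dot (joint_mean H (permute x p)) (product_mean H x)
   = N ^+ d * ((n%:R ^+ d)^-1 ^+ 2 * \prod_j G j).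
Proof.
transitivity (\sum_(i < n) n%:R^-1 * (n%:R ^+ d)^-1 *
    \sum_(s : {ffun 'I_d -> 'I_n}) \prod_j (N / n%:R * \sum_a psi j a (s j))).
  under eq_bigr => p _.
    rewrite /joint_mean /product_mean dotZl dotZr dot_suml mulrA mulr_sumr; over.
  rewrite exchange_big /=; apply: eq_bigr => i _; rewrite -mulr_sumr; congr (_ * _).
  rewrite (eq_bigr (fun p : {ffun 'I_d -> 'S_n} => \sum_(s : {ffun 'I_d -> 'I_n})
      tensor_kernel k (permute x p i) (recombine x s))) => [|p _]; last first.
    by rewrite dot_sumr; apply: eq_bigr => s _; rewrite dot_section.
  rewrite exchange_big /=; apply: eq_bigr => s _.
  rewrite /tensor_kernel /permute /recombine (sum_tuples (fun j q => psi j (q i) (s j))).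
  apply: eq_bigr => j _; apply: (mulfI (lt0r_neq0 n0)).
  by rewrite (sum_perm_point (psi j ^~ (s j))) mulrA mulrCA mulfV ?mulr1 ?gt_eqF.
rewrite sumr_const card_ord -[LHS]mulr_natl !mulrA mulfV ?mul1r ?gt_eqF//.
rewrite (sum_indices (fun j b => N / n%:R * \sum_a psi j a b)).
under eq_bigr do rewrite -mulr_sumr exchange_big /=.
rewrite big_split /= prodr_const card_ord exprMn exprVn; ring.
Qed.

Let diagonal_term :
  \sum_(p : {ffun 'I_d -> 'S_n}) dot (joint_mean H (permute x p)) (joint_mean H (permute x p))
   <= N ^+ d * (n%:R^-1 * K0 + ((n * n.-1)%:R ^+ d)^-1 * \prod_j G j).
Proof.
have G0 : 0 <= \prod_j G j.
  by apply: prodr_ge0 => j _; apply: sumr_ge0 => a _; exact: sumr_ge0.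
rewrite (eq_bigr (fun p : {ffun 'I_d -> 'S_n} => n%:R^-1 ^+ 2 * (\sum_i \sum_i' \prod_j psi j (p j i) (p j i')))); last first.
  move=> p _; rewrite /joint_mean dotZl dotZr mulrA -expr2; congr (_ * _).
  rewrite dot_suml; apply: eq_bigr => i _; rewrite dot_sumr; apply: eq_bigr => i' _.
  by rewrite dot_section.
rewrite -mulr_sumr exchange_big /=.
under eq_bigr => i _.
  rewrite exchange_big /=.
  under eq_bigr => i' _ do rewrite (sum_tuples (fun j q => psi j (q i) (q i'))).
  over.
rewrite exprVn ler_pdivrMl ?exprn_gt0//.
set A := N ^+ d * K0; set B := N ^+ d * (((n * n.-1)%:R ^+ d)^-1 * \prod_j G j).
have B0 : 0 <= B by rewrite !mulr_ge0 ?exprn_ge0 ?invr_ge0 ?exprn_ge0.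
apply: (@le_trans _ _ (\sum_(i < n) (A + n%:R * B))); last first.
  rewrite sumr_const card_ord -[leLHS]mulr_natl !mulrDr -/A -/B le_eqVlt.
  apply/orP; left; apply/eqP; rewrite /A; set B' := N ^+ d * (_ * _).
  by rewrite -/B /B'; field; rewrite gt_eqF.
apply: ler_sum => i _; rewrite (bigD1 i)//=; apply: lerD.
  apply: (@le_trans _ _ (\prod_(j < d) (N * K j))); last first.
    by rewrite big_split /= prodr_const card_ord.
  apply: ler_prod => j _; rewrite sumr_ge0//= /N mulr_natl -sumr_const.
  by apply: ler_sum => s _; exact: kernel_leK.
apply: (@le_trans _ _ (\sum_(i' < n) B)); last by rewrite sumr_const card_ord mulr_natl.
rewrite [leRHS](bigD1 i)//= -[leLHS]add0r lerD//; apply: ler_sum => i' ii'.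
apply: (@le_trans _ _ (\prod_(j < d) (N * ((n * n.-1)%:R^-1 * G j)))); last first.
  by rewrite !big_split /= !prodr_const card_ord exprVn.
apply: ler_prod => j _; rewrite sumr_ge0//=.
have nn0 : 0 < (n * n.-1)%:R :> R by rewrite natrM mulr_gt0.
rewrite mulrCA mulrC ler_pdivlMr// mulrC (sum_perm_pair (psi j)) 1?eq_sym//.
rewrite ler_wpM2l//; apply: ler_sum => a _.
by rewrite [leRHS](bigD1 a)//= lerDr.
Qed.

(** The product mean does not see the permutations, and it is the average of
    the permuted joint means; the second moment is therefore a variance, of
    which only the diagonal terms and the difference between sampling with and
    without replacement survive.  The bound is uniform in the data. *)
Lemma sum_sqr_dHSIC_permute :
  \sum_(p : {ffun 'I_d -> 'S_n}) dHSIC H (permute x p) ^+ 2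
    <= #|{ffun 'I_d -> 'S_n}|%:R *
       (K0 * (n%:R^-1 + ((n%:R / n.-1%:R) ^+ d - 1))).
Proof.
under eq_bigr => p _ do rewrite dHSICE product_mean_permute sqr_normB -!rkhs_dot_norm.
rewrite big_split sumrB -mulr_sumr cross_term /= sumr_const product_mean_sqr.
rewrite -[X in _ + X <= _]mulr_natl card_tuples.
have G0 : 0 <= \prod_j G j.
  by apply: prodr_ge0 => j _; apply: sumr_ge0 => a _; exact: sumr_ge0.
set S := \prod_j G j in G0 *; set m := (n%:R ^+ d)^-1 ^+ 2.
set r := (n%:R / n.-1%:R) ^+ d.
have r1 : 1 <= r.
  by apply: exprn_ege1; rewrite ler_pdivlMr// mul1r ler_nat leq_pred.
have SK : m * S <= K0.
  rewrite /m exprVn mulrC ler_pdivrMr ?exprn_gt0//.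
  apply: (@le_trans _ _ (\prod_(j < d) (n%:R * (n%:R * K j)))).
    apply: ler_prod => j _; rewrite sumr_ge0/=; last by move=> a _; exact: sumr_ge0.
    rewrite mulr_natl -[X in _ *+ X]card_ord -sumr_const; apply: ler_sum => a _.
    rewrite mulr_natl -[X in _ *+ X]card_ord -sumr_const; apply: ler_sum => b _.
    exact: kernel_leK.
  rewrite !big_split /= !prodr_const card_ord le_eqVlt; apply/orP; left.
  by apply/eqP; ring.
have rE : ((n * n.-1)%:R ^+ d)^-1 = r * m.
  rewrite /r /m natrM !exprMn !exprVn invfM expr2 invfM.
  by field; rewrite !expf_neq0// gt_eqF.
have := diagonal_term; rewrite rE -/S => hd.
have Nd : 0 <= N ^+ d by rewrite exprn_ge0.
have h1 : (r - 1) * (m * S) <= (r - 1) * K0 by rewrite ler_wpM2l// subr_ge0.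
have h2 := ler_wpM2l Nd h1.
apply: (le_trans (lerD (lerD hd (lexx _)) (lexx _))).
move: h2; set A := N ^+ d; set M := n%:R^-1; lra.
Qed.

End permuted_second_moment.

End dhsic_bounds.

(** * Measurability of the statistic *)

Section kernel_measurability.
Context (R : realType) (T : ptopologicalType) (h : T -> T -> R) (M : R).
Hypotheses (h_cont : continuous (fun u : T * T => h u.1 u.2))
  (h_psd : psd_kernel h) (h_bounds : forall x y, 0 <= h x y <= M)
  (T_sep : separable T).

(** The squared distance between the feature vectors of the two points. *)
Definition kernel_sqdist (y z : T) : R := h y y - 2 * h y z + h z z.

Let continuous_diag (f g : T -> T) : continuous f -> continuous g ->
  continuous (fun z => h (f z) (g z)).
Proof.
move=> cf cg z; apply: (@continuous_comp _ _ _ (fun z => (f z, g z)) (fun u => h u.1 u.2)).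
  by apply: cvg_pair => /=; [exact: cf|exact: cg].
exact: h_cont.
Qed.

Let continuous_section x : continuous (h x).
Proof. by apply: (@continuous_diag (fun=> x) id) => z; [exact: cvg_cst|exact: cvg_id]. Qed.

Let continuous_section_l x : continuous (h ^~ x).
Proof. by apply: (@continuous_diag id (fun=> x)) => z; [exact: cvg_id|exact: cvg_cst]. Qed.

(** Positive semi-definiteness at the points x, y, z with weights t, 1, -1 makes
    a quadratic in t nonnegative, and t is chosen near its minimizer. *)
Lemma kernel_lipschitz x y z :
  h x y <= h x z + Num.sqrt ((M + 1) * kernel_sqdist y z).
Proof.
have [sym psd] := h_psd.
set rho := kernel_sqdist y z; set D := h x y - h x z.
have M0 : 0 <= M by case/andP: (h_bounds x x) => /le_trans; apply.
suff D2 : D ^+ 2 <= (M + 1) * rho.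
  rewrite -lerBlDl -/D; apply: le_trans (ler_norm _) _.
  by rewrite -sqrtr_sqr ler_wsqrtr.
have quad t : 0 <= t ^+ 2 * h x x + 2 * t * D + rho.
  have := psd 3%N (fun i => [:: t; 1; -1]`_i) (fun i => nth x [:: x; y; z] i).
  rewrite !big_ord_recl !big_ord0 /= /rho /D /kernel_sqdist.
  rewrite (sym y x) (sym z x) (sym z y) => q.
  by apply: le_trans q _; rewrite le_eqVlt; apply/orP; left; apply/eqP; ring.
(* [M + 1] instead of [M] keeps the division meaningful when [M = 0]. *)
have M1 : 0 < M + 1 by rewrite ltr_wpDl.
have := quad (- D / (M + 1)); have [_ hM] := andP (h_bounds x x).
set s := D / (M + 1); have -> : D = s * (M + 1) by rewrite /s divfK// gt_eqF.
rewrite mulNr mulfK ?gt_eqF// sqrrN => q.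
have : s ^+ 2 * h x x <= s ^+ 2 * M by rewrite ler_wpM2l// sqr_ge0.
move=> q'; rewrite exprMn expr2.
rewrite mulrA [X in X <= _]mulrC ler_pM2l//.
have := sqr_ge0 s; move: q q'; rewrite expr2; lra.
Qed.

Context (dO : measure_display) (Om : measurableType dO).

Definition borel_measurable (S : topologicalType) (f : Om -> S) :=
  forall A, borel S A -> measurable (f @^-1` A).

Lemma measurable_comp_continuous (phi : T -> R) (f : Om -> T) :
  continuous phi -> borel_measurable f -> measurable_fun setT (fun t => phi (f t)).
Proof.
move=> cphi mf; apply: (measurability _ (RGenInftyO.measurableE R)) => //.
move=> _ [_ [x ->] <-]; rewrite setTI.
apply: (mf (phi @^-1` `]-oo, x[%classic)); apply: sub_sigma_algebra.
by apply: open_comp => // y _; exact: cphi.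
Qed.

Let continuous_sqdist y : continuous (kernel_sqdist y).
Proof.
move=> z; apply: cvgD; last by apply: (@continuous_diag id id) => ?; exact: cvg_id.
apply: cvgB; first exact: cvg_cst.
by apply: cvgM; [exact: cvg_cst|exact: continuous_section].
Qed.

Let continuous_sqdist_l z : continuous (kernel_sqdist ^~ z).
Proof.
move=> y; apply: cvgD; last exact: cvg_cst.
apply: cvgB; first by apply: (@continuous_diag id id) => ?; exact: cvg_id.
by apply: cvgM; [exact: cvg_cst|exact: continuous_section_l].
Qed.

(** The Borel sigma-algebra of the square of a separable space may exceed the
    product of the Borel sigma-algebras, so continuity of the kernel is not
    enough.  A positive semi-definite kernel is however the infimum, over the
    points q of a countable dense set, of the functions
    h x q + sqrt ((M + 1) * sqdist y q), which separate the two variables. *)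
Lemma measurable_psd_kernel (f g : Om -> T) : borel_measurable f ->
  borel_measurable g -> measurable_fun setT (fun t => h (f t) (g t)).
Proof.
move=> mf mg; have [D [Dcount Ddense]] := T_sep.
have D0 : D !=set0.
  by have [|t []] := Ddense setT _ openT; [exists point|exists t].
have /pfcard_geP[DE|[q]] := Dcount; first by move: D0; rewrite DE => -[].
apply: (measurability _ (RGenInftyO.measurableE R)) => //.
move=> _ [_ [a ->] <-]; rewrite setTI.
rewrite [X in measurable X](_ : _ = \bigcup_i [set t |
    h (f t) (q i) + Num.sqrt ((M + 1) * kernel_sqdist (g t) (q i)) < a]).
  apply: bigcupT_measurable => i.
  have : measurable_fun [set: Om] (fun t => h (f t) (q i) +
      Num.sqrt ((M + 1) * kernel_sqdist (g t) (q i))).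
    apply: measurable_funD.
      exact: (measurable_comp_continuous (@continuous_section_l (q i)) mf).
    apply: (@measurable_comp_continuous (fun y => Num.sqrt ((M + 1) * kernel_sqdist y (q i))) g) => //.
    move=> y; apply: (@continuous_comp _ _ _ (fun y => (M + 1) * kernel_sqdist y (q i)) Num.sqrt).
      by apply: cvgM; [exact: cvg_cst|exact: continuous_sqdist_l].
    exact: sqrt_continuous.
  move=> /(_ measurableT _ (measurable_itv `]-oo, a[)); rewrite setTI.
  rewrite (_ : _ @^-1` _ = [set t | h (f t) (q i) +
    Num.sqrt ((M + 1) * kernel_sqdist (g t) (q i)) < a])//.
apply/seteqP; split => t /=; rewrite in_itv /=.
  move=> ka.
  pose F z := h (f t) z + Num.sqrt ((M + 1) * kernel_sqdist (g t) z).
  have cF : continuous F.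
    move=> z; apply: cvgD; first exact: continuous_section.
    apply: (@continuous_comp _ _ _ (fun y => (M + 1) * kernel_sqdist (g t) y) Num.sqrt).
      by apply: cvgM; [exact: cvg_cst|exact: continuous_sqdist].
    exact: sqrt_continuous.
  have [||z [Fz Dz]] := Ddense (F @^-1` `]-oo, a[%classic).
  - exists (g t); rewrite /= in_itv/= /F.
    rewrite [kernel_sqdist _ _](_ : _ = 0) ?mulr0 ?sqrtr0 ?addr0//.
    by rewrite /kernel_sqdist; ring.
  - by apply: open_comp => // y _; exact: cF.
  have [i _ qi] := @surj _ _ _ _ q _ Dz.
  by exists i => //=; move: Fz; rewrite /= in_itv/= /F -qi.
by move=> [i _ /= hi]; apply: le_lt_trans hi; exact: kernel_lipschitz.
Qed.

End kernel_measurability.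

Section coordinate_measurability.
Context (d : nat) (X : 'I_d -> ptopologicalType).

Lemma measurable_coordinate (dO : measure_display) (Om : measurableType dO)
    (x : Om -> prod_space X) j :
  measurable_fun setT x -> borel_measurable (fun om => x om j).
Proof.
move=> mx A bA; rewrite -[X in measurable X]setTI.
apply: (mx measurableT [set y : prod_space X | A (y j)]).
by apply: sub_sigma_algebra; exists j => //; exists A => //; rewrite setTI.
Qed.

Lemma measurable_projection j : borel_measurable (fun w : prod_space X => w j).
Proof. by apply: (measurable_coordinate (x := id)); exact: measurable_id. Qed.

Lemma measurable_columns (A : forall j, set (X j)) : (forall j, borel (X j) (A j)) ->
  measurable [set y : prod_space X | forall j, A j (y j)].
Proof.
move=> bA; have -> : [set y : prod_space X | forall j, A j (y j)]
    = \bigcap_(j in [set: 'I_d]) [set y : prod_space X | A j (y j)].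
  by apply/seteqP; split => [y h j _|y h j]; exact: h.
apply: fin_bigcap_measurable => [|j _]; first exact: finite_finset.
exact: (measurable_projection (bA j)).
Qed.

End coordinate_measurability.

Section statistic_measurability.
Context (R : realType) (d : nat) (X : 'I_d -> ptopologicalType).
Context (X_separable : forall j, separable (X j)).
Context (k : forall j, X j -> X j -> R).
Arguments k : clear implicits.
Context (k_continuous : forall j, continuous (fun u : X j * X j => k j u.1 u.2))
  (k_psd : forall j, psd_kernel (k j))
  (K : 'I_d -> R) (k_bounds : forall j x y, 0 <= k j x y <= K j)
  (H : rkhs (tensor_kernel k)).
Context (dO : measure_display) (Om : measurableType dO).

Lemma measurable_tensor_kernel (x y : Om -> forall j, X j) :
  (forall j, borel_measurable (fun om => x om j)) ->
  (forall j, borel_measurable (fun om => y om j)) ->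
  measurable_fun setT (fun om => tensor_kernel k (x om) (y om)).
Proof.
move=> mx my; apply: measurable_prod => j _.
exact: (@measurable_psd_kernel _ _ (k j) (K j)).
Qed.

Lemma measurable_dHSIC n (x : 'I_n -> Om -> prod_space X) :
  (forall i j, borel_measurable (fun om => x i om j)) ->
  measurable_fun setT (fun om => dHSIC H (x ^~ om)).
Proof.
move=> mx.
pose J om := joint_mean H (x ^~ om); pose P om := product_mean H (x ^~ om).
pose S om := rkhs_dot (J om) (J om) - 2 * rkhs_dot (J om) (P om) + rkhs_dot (P om) (P om).
rewrite (_ : (fun om => _) = @Num.sqrt R \o S); last first.
  apply/funext => om /=; rewrite dHSICE -[LHS]ger0_norm// -sqrtr_sqr; congr Num.sqrt.
  by rewrite sqr_normB -!rkhs_dot_norm.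
apply: measurableT_comp; first by apply: continuous_measurable_fun; exact: sqrt_continuous.
have msum (I I' : finType) (u : I -> Om -> forall j, X j) (v : I' -> Om -> forall j, X j) (c c' : R) :
    (forall i j, borel_measurable (fun om => u i om j)) ->
    (forall i j, borel_measurable (fun om => v i om j)) ->
    measurable_fun setT (fun om => rkhs_dot
      (c *: \sum_i rkhs_section H (u i om)) (c' *: \sum_i rkhs_section H (v i om))).
  move=> mu mv.
  rewrite (_ : (fun om => _) = (fun om => c * (c' *
      \sum_i \sum_i' tensor_kernel k (u i om) (v i' om)))); last first.
    apply/funext => om; rewrite dotZl dotZr dot_suml; congr (_ * (_ * _)).
    apply: eq_bigr => i _; rewrite dot_sumr; apply: eq_bigr => i' _.
    exact: dot_section.
  do 2 apply: measurable_funM => //.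
  apply: measurable_sum => i; apply: measurable_sum => i'.
  exact: measurable_tensor_kernel.
have mrec (s : {ffun 'I_d -> 'I_n}) j :
    borel_measurable (fun om => recombine (x ^~ om) s j) by exact: mx.
apply: measurable_funD; last exact: msum.
apply: measurable_funB; first exact: msum.
by apply: measurable_funM => //; exact: msum.
Qed.

End statistic_measurability.

(** * Independence, the Laplace law and means of bounded variables *)

Section law_uniqueness.
Context (R : realType) (dO : measure_display) (Om : measurableType dO)
  (Q : probability Om R) (W : pointedType) (G : set (set W)).

Lemma law_unique (Y Y' : Om -> g_sigma_algebraType G) :
  measurable_fun setT Y -> measurable_fun setT Y' ->
  setI_closed G -> G setT ->
  (forall A, G A -> Q (Y @^-1` A) = Q (Y' @^-1` A)) ->
  forall A : set (g_sigma_algebraType G), measurable A ->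
    Q (Y @^-1` A) = Q (Y' @^-1` A).
Proof.
move=> mY mY' GI GT YY' A mA.
pose y : {mfun Om >-> g_sigma_algebraType G} :=
  HB.pack Y (isMeasurableFun.Build _ _ _ _ Y mY).
pose y' : {mfun Om >-> g_sigma_algebraType G} :=
  HB.pack Y' (isMeasurableFun.Build _ _ _ _ Y' mY').
suff : distribution Q y A = distribution Q y' A by [].
apply: (@measure_unique _ R (g_sigma_algebraType G) G (fun=> setT)) => //.
- by rewrite bigcup_const.
- by move=> _; apply: le_lt_trans (probability_le1 _ _) (ltry _).
Qed.

End law_uniqueness.

Section independence.
Context (R : realType) (dO : measure_display) (Om : measurableType dO)
  (Q : probability Om R) (I : finType) (F : I -> set (set Om)).
Hypotheses (F_sigma : forall i, sigma_algebra setT (F i))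
  (F_meas : forall i, F i `<=` measurable) (F_indep : mutually_independent Q F).

Let F_setT i : F i setT.
Proof. by have [F0 FC _] := F_sigma i; rewrite -(setD0 setT); exact: FC. Qed.

Let F_setI i : setI_closed (F i).
Proof.
move=> A B; rewrite -(sigma_algebra_id (F_sigma i)).
exact: (@measurableI _ (g_sigma_algebraType (F i))).
Qed.

Lemma measurable_bigcap_finite (J : {set I}) (E : I -> set Om) :
  (forall i, i \in J -> measurable (E i)) -> measurable (\bigcap_(i in [set` J]) E i).
Proof. by move=> mE; apply: fin_bigcap_measurable => // i /= /mE. Qed.

(** The intersections of events of the families indexed by [J] form a
    pi-system on which both sides are measures of the left-hand event. *)
Lemma independent_group (J J' : {set I}) (E : set Om) (D : I -> set Om) :
  (forall i, i \in J' -> i \notin J) -> <<s \bigcup_(i in [set` J]) F i >> E ->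
  (forall i, i \in J' -> F i (D i)) ->
  Q (E `&` \bigcap_(i in [set` J']) D i)
    = (Q E * Q (\bigcap_(i in [set` J']) D i))%E.
Proof.
move=> JJ' sE FD; set C := \bigcap_(i in _) _.
have mC : measurable C by apply: measurable_bigcap_finite => i /FD /F_meas.
pose G : set (set Om) := [set A | exists2 e : I -> set Om,
  (forall i, i \in J -> F i (e i)) & A = \bigcap_(i in [set` J]) e i].
have GT : G setT by exists (fun=> setT) => //; apply/seteqP; split.
have qC : 0 <= fine (Q C) by rewrite fine_ge0.
suff h : mrestr Q mC E = mscale (NngNum qC) Q E.
  have {}h : Q (E `&` C) = ((fine (Q C))%:E * Q E)%E by [].
  by rewrite h muleC fineK// fin_num_measure.
apply: (g_sigma_algebra_measure_unique G _ (fun=> setT)) => //.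
- by move=> _ [e Fe ->]; apply: measurable_bigcap_finite => i /Fe /F_meas.
- by rewrite bigcup_const.
- move=> _ _ [a Fa ->] [b Fb ->]; exists (fun i => a i `&` b i).
    by move=> i iJ; apply: F_setI; [exact: Fa|exact: Fb].
  by rewrite bigcapI.
- move=> _ [e Fe ->]; set A := \bigcap_(i in _) _.
  change (Q (A `&` C) = (fine (Q C))%:E * Q A)%E.
  rewrite fineK ?fin_num_measure// /A.
  pose m i := if i \in J then e i else D i.
  have -> : (\bigcap_(i in [set` J]) e i `&` C) = \bigcap_(i in [set` J :|: J']) m i.
    rewrite /C; apply/seteqP; split => [om [h h'] i /=|om h].
      by rewrite inE /m; case: ifP => [iJ _|_ /= iJ']; [exact: h|exact: h'].
    split=> i /= iJ; have := h i; rewrite /= inE iJ ?orbT /m => /(_ erefl).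
      by rewrite iJ.
    by rewrite (negPf (JJ' _ iJ)).
  rewrite F_indep => [|i]; last first.
    by rewrite inE /m; case: ifP => [iJ _|_ /= iJ']; [exact: Fe|exact: FD].
  rewrite (bigID (mem J)) /= muleC /C !F_indep//; congr (_ * _)%E.
    rewrite (eq_bigl (mem J')) => [|i]; last first.
      rewrite !inE; case: (boolP (i \in J')) => [/JJ' ->|_]; first by rewrite orbT.
      by rewrite orbF andbN.
    by apply: eq_bigr => i iJ; rewrite /m (negPf (JJ' _ iJ)).
  rewrite (eq_bigl (mem J)) => [|i]; first by apply: eq_bigr => i /= iJ; rewrite /m iJ.
  by rewrite !inE; case: (i \in J) => //=; rewrite andbF.
- move=> _; change (Q (setT `&` C) < +oo)%E.
  by rewrite setTI; apply: le_lt_trans (probability_le1 _ mC) (ltry _).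
- apply: smallest_sub sE; first exact: smallest_sigma_algebra.
  move=> A [i /= iJ FA]; apply: sub_sigma_algebra.
  exists (fun l => if l == i then A else setT).
    by move=> l lJ; case: eqVneq => [->|].
  apply/seteqP; split => [om Aom l /= lJ|om /(_ i iJ)]; last by rewrite eqxx.
  by case: eqVneq.
Qed.

End independence.

Section laplace.
Context (R : realType).
Local Notation mu := (@lebesgue_measure R).

Lemma lebesgue_measure_shift (c : R) (A : set R) : measurable A ->
  pushforward mu (fun x : measurableTypeR R => (x + c : measurableTypeR R)) A = mu A.
Proof.
have mshift : measurable_fun setT (fun x : measurableTypeR R => (x + c : measurableTypeR R)).
  by apply: measurable_funD.
pose s : {mfun measurableTypeR R >-> measurableTypeR R} :=
  HB.pack (fun x : measurableTypeR R => (x + c : measurableTypeR R))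
    (isMeasurableFun.Build _ _ _ _ _ mshift).
move=> mA; apply/esym.
apply: (@lebesgue_measure_unique _ (pushforward mu s)) => //= _ [[a b]] _ <-.
rewrite /pushforward (_ : s @^-1` `]a, b] = `]a - c, b - c]%classic); last first.
  by apply/seteqP; split => x /=; rewrite !in_itv/= ltrBlDr lerBrDr.
rewrite !lebesgue_measure_itv/= !lte_fin ltrD2r; case: ifP => // _.
by rewrite -EFinD; congr EFin; ring.
Qed.

Lemma measurable_laplace_pdf : measurable_fun setT (@laplace_pdf R).
Proof.
apply: measurable_funM => //; apply: measurableT_comp => //.
by apply: measurableT_comp => //; exact: measurableT_comp.
Qed.

Lemma laplace_pdf_ge0 (x : R) : 0 <= laplace_pdf x.
Proof. by rewrite divr_ge0// expR_ge0. Qed.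

(** Shifting a standard Laplace variable by [c] multiplies its density by at
    most [exp |c|]: this is the whole privacy content of the noise. *)
Lemma laplace_prob_shift (c : R) (A : set R) : measurable A ->
  (laplace_prob [set x | A (x + c)%R] <= (expR `|c|%R)%:E * laplace_prob A)%E.
Proof.
move=> mA.
have mshift : measurable_fun setT (fun x : measurableTypeR R => (x + c : measurableTypeR R)).
  by apply: measurable_funD.
have mshiftN : measurable_fun setT (fun x : R => x - c) by apply: measurable_funB.
have mpdf : measurable_fun setT (fun y : R => (laplace_pdf (y - c))%:E).
  by apply/measurable_EFinP; apply: measurableT_comp mshiftN; exact: measurable_laplace_pdf.
have -> : laplace_prob [set x | A (x + c)]
    = (\int[mu]_(y in A) (laplace_pdf (y - c)%R)%:E)%E.
  rewrite /laplace_prob; transitivity (\int[pushforward mu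
      (fun x : measurableTypeR R => (x + c)%R : measurableTypeR R)]_(y in A)
        (laplace_pdf (y - c)%R)%:E)%E.
    rewrite ge0_integral_pushforward//.
    - by apply: eq_integral => x _ /=; rewrite addrK.
    - exact: measurable_funTS.
    - by move=> y _; rewrite lee_fin laplace_pdf_ge0.
  by apply: eq_measure_integral => B mB _; exact: lebesgue_measure_shift.
rewrite /laplace_prob -ge0_integralZl//.
- apply: ge0_le_integral => //.
  + by move=> y _; rewrite lee_fin laplace_pdf_ge0.
  + exact: measurable_funTS.
  + apply: measurable_funTS; apply/measurable_EFinP.
    by apply: measurable_funM => //; exact: measurable_laplace_pdf.
  + move=> y _; rewrite -EFinM lee_fin /laplace_pdf mulrA ler_wpM2r// -expRD ler_expR.
    have := ler_normD (y - c) c; rewrite subrK; lra.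
- by apply: measurable_funTS; apply/measurable_EFinP; exact: measurable_laplace_pdf.
- by move=> y _; rewrite lee_fin laplace_pdf_ge0.
Qed.

End laplace.

Lemma measurable_ge_set (R : realType) (dO : measure_display)
    (Om : measurableType dO) (f : Om -> R) (t : R) : measurable_fun setT f ->
  measurable [set om | t <= f om].
Proof.
move=> mf; rewrite -[X in measurable X]setTI.
exact: (@measurable_fun_le _ _ R setT (cst t) f).
Qed.

Section expectation_tools.
Context (R : realType) (dO : measure_display) (Om : measurableType dO)
  (Q : probability Om R).

Definition bounded_variable (f : Om -> R) : Prop :=
  measurable_fun setT f /\ exists M, forall om, `|f om| <= M.

Lemma bounded_variable_integrable f : bounded_variable f ->
  Q.-integrable setT (EFin \o f).
Proof.
move=> [mf [M fM]]; apply: measurable_bounded_integrable => //.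
  by apply: le_lt_trans (probability_le1 _ _) (ltry _).
exists M; split; first exact: num_real.
by move=> N MN om _; apply: le_trans (fM om) (ltW MN).
Qed.

Lemma bounded_variable_cst c : bounded_variable (fun=> c).
Proof. by split => //; exists `|c|. Qed.

Lemma bounded_variableD f g : bounded_variable f -> bounded_variable g ->
  bounded_variable (fun om => f om + g om).
Proof.
move=> [mf [M fM]] [mg [N gN]]; split; first exact: measurable_funD.
by exists (M + N) => om; apply: le_trans (ler_normD _ _) (lerD _ _).
Qed.

Lemma bounded_variableM f g : bounded_variable f -> bounded_variable g ->
  bounded_variable (fun om => f om * g om).
Proof.
move=> [mf [M fM]] [mg [N gN]]; split; first exact: measurable_funM.
by exists (M * N) => om; rewrite normrM ler_pM.
Qed.

Lemma bounded_variable_sum (I : Type) (r : seq I) (f : I -> Om -> R) :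
  (forall i, bounded_variable (f i)) ->
  bounded_variable (fun om => \sum_(i <- r) f i om).
Proof.
move=> bf; elim: r => [|i r IH].
  by under eq_fun do rewrite big_nil; exact: bounded_variable_cst.
by under eq_fun do rewrite big_cons; exact: bounded_variableD.
Qed.

Lemma bounded_variable_prod (I : Type) (r : seq I) (f : I -> Om -> R) :
  (forall i, bounded_variable (f i)) ->
  bounded_variable (fun om => \prod_(i <- r) f i om).
Proof.
move=> bf; elim: r => [|i r IH].
  by under eq_fun do rewrite big_nil; exact: bounded_variable_cst.
by under eq_fun do rewrite big_cons; exact: bounded_variableM.
Qed.

Lemma mean_sum (I : Type) (r : seq I) (f : I -> Om -> R) :
  (forall i, bounded_variable (f i)) ->
  \int[Q]_om (\sum_(i <- r) f i om) = \sum_(i <- r) \int[Q]_om f i om.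
Proof.
move=> bf; elim: r => [|i r IH].
  by under eq_Rintegral do rewrite big_nil; rewrite Rintegral_cst// mul0r big_nil.
under eq_Rintegral do rewrite big_cons.
rewrite big_cons RintegralD// ?IH//; apply: bounded_variable_integrable => //.
exact: bounded_variable_sum.
Qed.

Lemma mean_cst c : \int[Q]_om (fun=> c) om = c.
Proof. by rewrite Rintegral_cst//= probability_setT mulr1. Qed.

Lemma mean_le f g : bounded_variable f -> bounded_variable g ->
  (forall om, f om <= g om) -> \int[Q]_om f om <= \int[Q]_om g om.
Proof. by move=> bf bg fg; apply: le_Rintegral => //; exact: bounded_variable_integrable. Qed.

Lemma bounded_variable_indic (A : set Om) : measurable A ->
  bounded_variable (\1_A : Om -> R).
Proof.
move=> mA; split; first exact: measurable_indic.
by exists 1 => om; rewrite indicE; case: (_ \in _); rewrite ?normr1 ?normr0.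
Qed.

Lemma mean_indic (A : set Om) : measurable A ->
  \int[Q]_om (\1_A om : R) = fine (Q A).
Proof. by move=> mA; rewrite /Rintegral integral_indic ?setIT. Qed.

Lemma prob_le_sum (I : Type) (r : seq I) (A : I -> set Om) (S : set Om) :
  (forall i, measurable (A i)) -> measurable S ->
  (forall om, S om -> \sum_(i <- r) (\1_(A i) om : R) >= 1) ->
  fine (Q S) <= \sum_(i <- r) fine (Q (A i)).
Proof.
move=> mA mS SA; have bA i := bounded_variable_indic (mA i).
rewrite -mean_indic// (eq_bigr (fun i => \int[Q]_om (\1_(A i) om : R))) => [|i _].
  rewrite -mean_sum//; apply: mean_le => [||om]; first exact: bounded_variable_indic.
    exact: bounded_variable_sum.
  rewrite [leLHS]indicE; case: (boolP (om \in S)) => [/set_mem/SA//|_].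
  by apply: sumr_ge0 => i _; rewrite indicE ler0n.
by rewrite mean_indic.
Qed.

Lemma mean_markov f (A : set Om) c : bounded_variable f ->
  (forall om, 0 <= f om) -> measurable A -> (forall om, A om -> c <= f om) ->
  0 < c -> (Q A <= (c^-1 * \int[Q]_om f om)%:E)%E.
Proof.
move=> bf f0 mA Af c0.
have bA := bounded_variable_indic mA.
have EA : Q A = (\int[Q]_om (\1_A om : R))%:E.
  by rewrite mean_indic// fineK// fin_num_measure.
rewrite EA lee_fin ler_pdivlMl// -RintegralZl//; last exact: bounded_variable_integrable.
apply: mean_le => //; first exact: bounded_variableM (bounded_variable_cst c) bA.
move=> om; rewrite indicE; case: (boolP (_ \in _)) => /= [/set_mem/Af|_].
  by rewrite mulr1.
by rewrite mulr0.
Qed.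

(** The law of the pair is a product measure, and Tonelli's theorem applies. *)
Lemma mean_mul_independent (U V : Om -> R) :
  bounded_variable U -> bounded_variable V ->
  (forall om, 0 <= U om) -> (forall om, 0 <= V om) ->
  (forall A B, measurable A -> measurable B ->
    Q (U @^-1` A `&` V @^-1` B) = (Q (U @^-1` A) * Q (V @^-1` B))%E) ->
  \int[Q]_om (U om * V om) = \int[Q]_om U om * \int[Q]_om V om.
Proof.
move=> bU bV U0 V0 UV; have [mU _] := bU; have [mV _] := bV.
pose u : {mfun Om >-> R} := HB.pack U (isMeasurableFun.Build _ _ _ _ U mU).
pose v : {mfun Om >-> R} := HB.pack V (isMeasurableFun.Build _ _ _ _ V mV).
have mUV : measurable_fun setT (fun om => (U om, V om)).
  exact: measurable_fun_pair.
pose uv : {mfun Om >-> (R * R)%type} :=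
  HB.pack (fun om => (U om, V om)) (isMeasurableFun.Build _ _ _ _ _ mUV).
(* The absolute values make the integrand nonnegative on the whole plane. *)
pose f (x : R * R) : \bar R := (`|x.1| * `|x.2|)%:E.
have mf : measurable_fun setT f.
  by apply/measurable_EFinP; apply: measurable_funM; apply: measurableT_comp.
have f0 x : (0 <= f x)%E by rewrite lee_fin mulr_ge0.
have lawE : (\int[distribution Q uv]_x f x =
   \int[(distribution Q u \x distribution Q v)%E]_x f x)%E.
  apply: eq_measure_integral => A mA _; apply/esym.
  by apply: product_measure_unique => // B C mB mC; exact: UV.
have EUV : (\int[Q]_om (U om * V om)%:E = (\int[Q]_om (U om)%:E) * \int[Q]_om (V om)%:E)%E.
  transitivity (\int[distribution Q uv]_x f x)%E.
    rewrite ge0_integral_distribution//; apply: eq_integral => om _ /=.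
    by rewrite /f /= !ger0_norm.
  rewrite lawE fubini_tonelli1//.
  have mnorm : measurable_fun setT (fun y : R => `|y|%:E).
    by apply/measurable_EFinP; exact: normr_measurable.
  transitivity (\int[distribution Q u]_x (`|x|%:E * \int[distribution Q v]_y `|y|%:E))%E.
    apply: eq_integral => x _; rewrite /fubini_F /f /=.
    by under eq_integral do rewrite EFinM; rewrite ge0_integralZl.
  rewrite ge0_integralZr//; last by apply: integral_ge0.
  rewrite !ge0_integral_distribution//.
  by congr (_ * _)%E; apply: eq_integral => om _ /=; rewrite ger0_norm.
rewrite /Rintegral EUV fineM//; apply: integrable_fin_num => //;
  exact: bounded_variable_integrable.
Qed.

(** The variables being pairwise uncorrelated, only the diagonal of the second
    moment is not cancelled; Chebyshev's inequality concludes. *)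
Lemma average_deviation (n : nat) (g : 'I_n -> Om -> R) (M a : R) (eta : R) :
  (0 < n)%N -> 0 < eta ->
  (forall i, measurable_fun setT (g i)) ->
  (forall i om, 0 <= g i om <= M) ->
  (forall i, \int[Q]_om g i om = a) ->
  (forall i l, i != l -> \int[Q]_om (g i om * g l om) = a * a) ->
  (Q [set om | (eta <= `|n%:R^-1 * \sum_(i < n) g i om - a|)%R]
     <= (M ^+ 2 / (n%:R * eta ^+ 2))%:E)%E.
Proof.
move=> n0 eta0 mg gM ga gg.
have bg i : bounded_variable (g i).
  split => //; exists M => om; have /andP[g0 gM'] := gM i om.
  by rewrite ger0_norm.
pose S om := n%:R^-1 * \sum_(i < n) g i om - a.
have bS : bounded_variable S.
  apply: (bounded_variableD _ (bounded_variable_cst (- a))).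
  by apply: bounded_variableM (bounded_variable_cst _) (bounded_variable_sum _ _).
have bS2 : bounded_variable (fun om => S om ^+ 2).
  by under eq_fun do rewrite expr2; exact: bounded_variableM.
have nn0 : 0 < n%:R :> R by rewrite ltr0n.
have M0 : 0 <= M ^+ 2 by rewrite sqr_ge0.
suff ES : \int[Q]_om (S om ^+ 2) <= M ^+ 2 / n%:R.
  apply: le_trans (mean_markov (c := eta ^+ 2) bS2 _ _ _ _) _.
  - by move=> om; exact: sqr_ge0.
  - rewrite -[X in measurable X]setTI.
    apply: (@measurable_fun_le _ _ R setT (cst eta) (fun om => `|S om|)) => //.
    by apply: measurableT_comp => //; have [] := bS.
  - by move=> om /= h; rewrite -[leRHS]real_normK ?num_real// ler_pXn2r// ?nnegrE// ltW.
  - by rewrite exprn_gt0.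
  rewrite lee_fin; apply: le_trans (ler_wpM2l _ ES) _.
    by rewrite invr_ge0 exprn_ge0// ltW.
  by rewrite (invfM n%:R) [leLHS]mulrC mulrA.
pose c := n%:R^-1 * n%:R^-1 : R.
have SE om : S om ^+ 2 = c * (\sum_i \sum_l g i om * g l om)
    + (- 2 * a * n%:R^-1) * (\sum_i g i om) + a ^+ 2.
  rewrite (eq_bigr (fun i => g i om * \sum_l g l om)) => [|i _]; last by rewrite mulr_sumr.
  by rewrite -mulr_suml /S /c; ring.
have bgg i l : bounded_variable (fun om => g i om * g l om) by exact: bounded_variableM.
have bg1 := bounded_variable_sum (index_enum 'I_n) bg.
have bg2 i := bounded_variable_sum (index_enum 'I_n) (bgg i).
have bg3 := bounded_variable_sum (index_enum 'I_n) bg2.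
have bcM b f : bounded_variable f -> bounded_variable (fun om => b * f om).
  by move=> bf; apply: bounded_variableM bf; exact: bounded_variable_cst.
under eq_Rintegral do rewrite SE.
rewrite RintegralD//; last 2 first.
- by apply: bounded_variable_integrable; apply: bounded_variableD; apply: bcM.
- exact: bounded_variable_integrable (bounded_variable_cst _).
rewrite RintegralD//; last 2 first.
- by apply: bounded_variable_integrable; apply: bcM.
- by apply: bounded_variable_integrable; apply: bcM.
rewrite mean_cst !RintegralZl//; last 2 first.
- exact: bounded_variable_integrable.
- exact: bounded_variable_integrable.
rewrite !mean_sum//.
under eq_bigr do rewrite mean_sum//.
under [X in _ + _ * X + _]eq_bigr do rewrite ga.
rewrite sumr_const card_ord -[a *+ n]mulr_natl.
have h : \sum_(i < n) \sum_(l < n) \int[Q]_om (g i om * g l om)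
    <= n%:R * (M ^+ 2 + n%:R * a ^+ 2).
  rewrite mulr_natl -[X in _ *+ X](card_ord n) -sumr_const; apply: ler_sum => i _.
  rewrite (bigD1 i)//= lerD//.
    rewrite -[leRHS]mean_cst; apply: mean_le => //; first exact: bounded_variable_cst.
    by move=> om; have /andP[? ?] := gM i om; rewrite expr2 ler_pM.
  rewrite (eq_bigr (fun=> a ^+ 2)) => [|l li]; last by rewrite gg 1?eq_sym// expr2.
  rewrite mulr_natl -[X in _ *+ X](card_ord n) -sumr_const [leRHS](bigD1 i)//=.
  by rewrite lerDr sqr_ge0.
have c0 : 0 <= c by rewrite mulr_ge0// invr_ge0 ltW.
have := ler_wpM2l c0 h; rewrite /c => h'.
apply: (@le_trans _ _ (n%:R^-1 * n%:R^-1 * (n%:R * (M ^+ 2 + n%:R * a ^+ 2))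
   + (- 2 * a * n%:R^-1) * (n%:R * a) + a ^+ 2)).
  by rewrite !lerD.
rewrite le_eqVlt; apply/orP; left; apply/eqP; field; rewrite gt_eqF//.
Qed.

End expectation_tools.

(** * Privacy *)

Section rank_test.
Context (R : realType) (B : nat).
Implicit Types M : 'I_B.+1 -> R.

(** The index [c] is among the indices that are counted, which accounts for the
    unit added in the numerator of the permutation p-value. *)
Definition rank_pvalue M (c : 'I_B.+1) : R :=
  B.+1%:R^-1 * \sum_(b < B.+1) (M c <= M b)%R%:R.

(** Among the indices with p-value at most [alpha], take one whose value is
    smallest: all the others are counted in its rank. *)
Lemma sum_rank_pvalue_le M (alpha : R) : 0 <= alpha ->
  \sum_(c < B.+1) (rank_pvalue M c <= alpha)%R%:R <= alpha * B.+1%:R.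
Proof.
move=> a0; pose S := [pred c | rank_pvalue M c <= alpha].
have [c0 Sc0|S0] := pickP S; last first.
  rewrite big1 ?mulr_ge0// => c _; by have := S0 c; rewrite /= => ->.
have [c Sc cmin] := @Order.TotalTheory.arg_minP _ _ _ c0 S M Sc0.
have : rank_pvalue M c <= alpha by [].
rewrite /rank_pvalue mulrC ler_pdivrMr ?ltr0n//; apply: le_trans.
apply: ler_sum => b _; have := cmin b; rewrite /S /=.
by case: (rank_pvalue M b <= alpha) => [->|_] //; rewrite ler0n.
Qed.

Lemma rank_pvalue_shift M M' (D : R) (c : 'I_B.+1) :
  M c + D <= M' c -> (forall b, b != c -> M' b <= M b + D) ->
  rank_pvalue M' c <= rank_pvalue M c.
Proof.
move=> Mc Mb; rewrite ler_wpM2l ?invr_ge0//; apply: ler_sum => b _.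
have [->|bc] := eqVneq b c; first by rewrite !lexx.
rewrite ler_nat; case: (leP (M' c) (M' b)) => // h; rewrite lt0b.
by rewrite -(lerD2r D); apply: le_trans Mc (le_trans h (Mb _ bc)).
Qed.

Lemma measurable_rank_pvalue (dT : measure_display) (T : measurableType dT)
    (M : 'I_B.+1 -> T -> R) (c : 'I_B.+1) (alpha : R) :
  (forall b, measurable_fun setT (M b)) ->
  measurable [set t | rank_pvalue (M ^~ t) c <= alpha].
Proof.
move=> mM; rewrite -[X in measurable X]setTI.
apply: (@measurable_fun_le _ _ R setT _ (cst alpha)) => //.
apply: measurable_funM => //; apply: measurable_sum => b.
rewrite (_ : (fun t => _) = \1_[set t | M c t <= M b t]).
  apply: measurable_indic; rewrite -[X in measurable X]setTI.
  exact: measurable_fun_le.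
apply/funext => t; rewrite indicE; congr ((nat_of_bool _)%:R).
by apply/idP/idP => [h|/set_mem]; [exact/mem_set|].
Qed.

End rank_test.

Section test_as_rank_test.
Context (R : realType) (d : nat) (X : 'I_d -> ptopologicalType).
Context (k : forall j, X j -> X j -> R) (H : rkhs (tensor_kernel k)).
Context (K : 'I_d -> R) (alpha eps del : R) (n B : nat).
Implicit Types (x : 'I_n -> prod_space X) (p : 'I_B -> {ffun 'I_d -> 'S_n}).

Lemma dpdHSIC_testE x p z :
  dpdHSIC_test H K alpha eps del x p z
    = (rank_pvalue (noisy_statistic H K eps del x p z) ord0 <= alpha).
Proof.
by rewrite /dpdHSIC_test /dp_pvalue /rank_pvalue big_ord_recl lexx [1 + _]addrC.
Qed.

End test_as_rank_test.

Section privacy.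
Context (R : realType).

Section shifted_noise.
Context (B : nat) (dO : measure_display) (Om : measurableType dO)
  (Q : probability Om R) (z : 'I_B.+1 -> {RV Q >-> R}) (z_iid : iid_laplace z).

Let rest : set (set Om) :=
  \bigcup_(i in [set` [set b : 'I_B.+1 | b != ord0]%SET]) Defs.generated (z i) measurable.

Let gen_meas (b : 'I_B.+1) : Defs.generated (z b) measurable `<=` measurable.
Proof. by move=> A [C mC <-]; exact: measurable_funP. Qed.

Let rest_meas : <<s rest >> `<=` measurable.
Proof.
apply: smallest_sub; first exact: sigma_algebra_measurable.
by move=> A [b _]; exact: gen_meas.
Qed.

Let measurable_id : measurable_fun setT (id : Om -> g_sigma_algebraType rest).
Proof. by move=> _ A mA; rewrite setTI; exact: rest_meas. Qed.

Let id_rv : {mfun Om >-> g_sigma_algebraType rest} :=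
  HB.pack (id : Om -> g_sigma_algebraType rest)
    (isMeasurableFun.Build _ _ _ _ _ measurable_id).

Let measurable_pair : measurable_fun setT
  (fun om : Om => (om : g_sigma_algebraType rest, z ord0 om)).
Proof. by apply: measurable_fun_pair => //; exact: measurable_id. Qed.

Let pair_rv : {mfun Om >-> (g_sigma_algebraType rest * R)%type} :=
  HB.pack (fun om : Om => (om : g_sigma_algebraType rest, z ord0 om))
    (isMeasurableFun.Build _ _ _ _ _ measurable_pair).

Let noise_product (A : set (g_sigma_algebraType rest * R)) : measurable A ->
  Q [set om | A (om, z ord0 om)]
    = ((distribution Q id_rv \x distribution Q (z ord0))%E A).
Proof.
move=> mA; rewrite (@product_measure_unique _ _ _ _ _ _ _ (distribution Q pair_rv))//.
move=> C D mC mD.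
have [_ indep] := z_iid.
have := @independent_group _ _ _ Q _ _ _ gen_meas indep
  [set b : 'I_B.+1 | b != ord0]%SET [set ord0]%SET C (fun=> z ord0 @^-1` D).
have -> : \bigcap_(i in [set` [set (ord0 : 'I_B.+1)]%SET]) (z ord0 @^-1` D) = z ord0 @^-1` D.
  apply/seteqP; split => [om /(_ ord0)|om Dom b _] //.
  by apply; rewrite /= inE.
apply => //.
- by move=> b; apply: sigma_algebra_preimage; exact: sigma_algebra_measurable.
- by move=> b; rewrite !inE => /eqP ->.
- by move=> b; rewrite inE => /eqP ->; exists D => //; rewrite setTI.
Qed.

Definition shift_first (c : R) (u : 'I_B.+1 -> R) : 'I_B.+1 -> R :=
  fun b => if b == ord0 then u b + c else u b.

(** Freeze the other noise variables, of which the first one is independent,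
    and compare the one-dimensional Laplace laws section by section. *)
Lemma prob_shift_first (c : R) (A : set ('I_B.+1 -> R)) :
  (forall (dT : measure_display) (T : measurableType dT) (u : 'I_B.+1 -> T -> R),
     (forall b, measurable_fun setT (u b)) -> measurable [set t | A (u ^~ t)]) ->
  (Q [set om | A (shift_first c (z ^~ om))]
    <= (expR `|c|%R)%:E * Q [set om | A (z ^~ om)])%E.
Proof.
move=> mA.
pose u (a : R) (b : 'I_B.+1) (w : g_sigma_algebraType rest * R) : R :=
  if b == ord0 then w.2 + a else z b w.1.
have mu a b : measurable_fun setT (u a b).
  rewrite /u; case: eqVneq => b0; first exact: measurable_funD.
  apply: (@measurableT_comp _ _ _ _ _ _ (z b : g_sigma_algebraType rest -> R)) => //.
  move=> _ C mC; rewrite setTI; apply: sub_sigma_algebra.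
  by exists b; [rewrite /= inE|exists C => //; rewrite setTI].
pose D a := [set w : g_sigma_algebraType rest * R | A (u a ^~ w)].
have mD a : measurable (D a) by apply: mA.
have DE a : [set om | D a (om, z ord0 om)] = [set om | A (shift_first a (z ^~ om))].
  apply/funext => om; rewrite /D /=; congr (A _); apply/funext => b.
  by rewrite /u /shift_first /=; case: eqVneq => // ->.
rewrite -DE noise_product//.
have -> : [set om | A (z ^~ om)] = [set om | D 0 (om, z ord0 om)].
  rewrite DE; apply/funext => om /=; congr (A _); apply/funext => b.
  by rewrite /shift_first addr0; case: ifP.
rewrite noise_product// /product_measure1 -ge0_integralZl//; last exact: measurable_fun_xsection.
apply: ge0_le_integral => //.
- exact: measurable_fun_xsection.
- by apply: measurable_funeM; exact: measurable_fun_xsection.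
move=> om _ /=.
have mx a := measurable_xsection om (mD a).
have [lap _] := z_iid; rewrite !lap//.
apply: le_trans (laplace_prob_shift c (mx 0)).
rewrite le_eqVlt; apply/orP; left; apply/eqP; congr laplace_prob.
apply/funext => t; rewrite /xsection /= !in_setE /D /=; congr (A _).
by apply/funext => b; rewrite /u /=; case: eqVneq => // _; rewrite addr0.
Qed.

End shifted_noise.

Lemma expR_privacy_level (eps del : R) : 0 <= del < 1 ->
  expR (privacy_level eps del) = expR eps / (1 - del).
Proof.
move=> /andP[_ d1]; rewrite /privacy_level expRD div1r lnK//.
by rewrite posrE invr_gt0 subr_gt0.
Qed.

Lemma privacy_level_gt0 (eps del : R) : 0 < eps -> 0 <= del < 1 ->
  0 < privacy_level eps del.
Proof.
move=> e0 /andP[d0 d1]; rewrite /privacy_level ltr_pwDl// ln_ge0// div1r.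
by rewrite invf_ge1 ?subr_gt0// lerBlDr lerDl.
Qed.

(** A likelihood ratio bound [exp eps / (1 - del)] on a probability [a <= 1]
    reads [a <= exp eps * b + del * a]. *)
Lemma pure_to_approximate_privacy (eps del a b : R) : 0 <= del < 1 -> a <= 1 ->
  a <= expR (privacy_level eps del) * b -> a <= expR eps * b + del.
Proof.
move=> del01; rewrite expR_privacy_level// mulrAC => a1; have /andP[d0 d1] := del01.
rewrite ler_pdivlMr ?subr_gt0// => h.
have := ler_wpM2l d0 a1; lra.
Qed.

Context (d : nat) (X : 'I_d -> ptopologicalType).
Context (k : forall j, X j -> X j -> R).
Arguments k : clear implicits.
Context (k_psd : forall j, psd_kernel (k j))
  (K : 'I_d -> R) (k_bounds : forall j x y, 0 <= k j x y <= K j)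
  (H : rkhs (tensor_kernel k)) (alpha eps del : R) (n B : nat).

Lemma neighbours_sym (x y : 'I_n -> prod_space X) : neighbours x y -> neighbours y x.
Proof. by move=> [i xy]; exists i => l /xy ->. Qed.

(** Half of the rise of the first noise pays for a decrease of the first
    statistic, the other half for an increase of the others. *)
Lemma dpdHSIC_test_shift (x y : 'I_n -> prod_space X)
    (p : 'I_B -> {ffun 'I_d -> 'S_n}) (u : 'I_B.+1 -> R) :
  0 < eps -> 0 <= del < 1 -> neighbours x y ->
  dpdHSIC_test H K alpha eps del x p u ->
  dpdHSIC_test H K alpha eps del y p (shift_first (privacy_level eps del) u).
Proof.
move=> e0 d01 xy; rewrite !dpdHSIC_testE; apply: le_trans.
have xi0 := privacy_level_gt0 e0 d01.
apply: (@rank_pvalue_shift _ _ _ _ (sensitivity K n)) => [|b b0].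
  rewrite /noisy_statistic /shift_first eqxx mulrDr mulfVK ?gt_eqF//.
  have := dHSIC_sensitivity H k_psd k_bounds (with_identity p ord0) xy; lra.
rewrite /noisy_statistic /shift_first (negPf b0).
have := dHSIC_sensitivity H k_psd k_bounds (with_identity p b) (neighbours_sym xy); lra.
Qed.

Lemma dpdHSIC_private (dO : measure_display) (Om : measurableType dO)
    (Q : probability Om R) (z : 'I_B.+1 -> {RV Q >-> R}) :
  0 < eps -> 0 <= del < 1 -> iid_laplace z ->
  differentially_private eps del Q
    (fun (x : 'I_n -> prod_space X) (p : 'I_B -> {ffun 'I_d -> 'S_n}) (om : Om) =>
       dpdHSIC_test H K alpha eps del x p (z ^~ om)).
Proof.
move=> e0 d01 z_iid S p x y _ xy.
set xi := privacy_level eps del.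
have xi0 : 0 <= xi by rewrite ltW// privacy_level_gt0.
pose A (v : bool) (x : 'I_n -> prod_space X) : set ('I_B.+1 -> R) :=
  [set u | dpdHSIC_test H K alpha eps del x p u = v].
have mA v x' (dT : measure_display) (T : measurableType dT) (u : 'I_B.+1 -> T -> R) :
    (forall b, measurable_fun setT (u b)) -> measurable [set t | A v x' (u ^~ t)].
  move=> mu.
  pose E := [set t | rank_pvalue (noisy_statistic H K eps del x' p (u ^~ t)) ord0 <= alpha].
  have mE : measurable E.
    apply: (@measurable_rank_pvalue _ _ _ _
      (fun b t => noisy_statistic H K eps del x' p (u ^~ t) b)) => b.
    by apply: measurable_funD => //; apply: measurable_funM.
  case: v.
    by rewrite [X in measurable X](_ : _ = E)//;
      apply/seteqP; split => t /=; rewrite /A /= dpdHSIC_testE.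
  rewrite [X in measurable X](_ : _ = ~` E); first exact: measurableC.
  by apply/seteqP; split => t /=; rewrite /A /E /= dpdHSIC_testE; [move=> ->|move=> /negP/negbTE].
have shiftA v : A v x `<=` [set u | A v y (shift_first (if v then xi else - xi) u)].
  case: v => u; rewrite /A /=; first exact: dpdHSIC_test_shift.
  move=> hx; apply/negbTE/negP => h.
  have := dpdHSIC_test_shift e0 d01 (neighbours_sym xy) h; rewrite -/xi.
  rewrite [shift_first _ _](_ : _ = u) ?hx//.
  by apply/funext => b; rewrite /shift_first; case: (b == ord0) => //; rewrite subrK.
have key v : (Q [set om | A v x (z ^~ om)]
    <= (expR eps)%:E * Q [set om | A v y (z ^~ om)] + del%:E)%E.
  have mz v' x' : measurable [set om | A v' x' (z ^~ om)] by apply: mA.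
  have h : (Q [set om | A v x (z ^~ om)]
      <= (expR xi)%:E * Q [set om | A v y (z ^~ om)])%E.
    apply: (@le_trans _ _ (Q [set om | A v y (shift_first (if v then xi else - xi) (z ^~ om))])).
      apply: le_measure; rewrite ?inE//.
      - apply: (mA v y _ _ (fun b om => shift_first (if v then xi else - xi) (z ^~ om) b)) => b.
        by rewrite /shift_first /=; case: (b == ord0) => //; apply: measurable_funD.
      - by move=> om; exact: shiftA.
    have := prob_shift_first z_iid (if v then xi else - xi) (mA v y).
    by case: v; rewrite ?normrN ger0_norm.
  have f1 := fin_num_measure Q _ (mz v x); have f2 := fin_num_measure Q _ (mz v y).
  move: h; rewrite -(fineK f1) -(fineK f2) -!EFinM -EFinD !lee_fin.
  apply: pure_to_approximate_privacy => //.
  by rewrite -lee_fin fineK// probability_le1.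
pose M x := fun om => dpdHSIC_test H K alpha eps del x p (z ^~ om).
have [d0 _] := andP d01.
have [ST|ST] := pselect (S true); have [SF|SF] := pselect (S false).
- have ME x' : M x' @^-1` S = setT by apply/seteqP; split => // om _ /=; case: (M x' om).
  rewrite !ME !probability_setT mule1 -EFinD lee_fin.
  by have := expR_gt1Dx (lt0r_neq0 e0); lra.
- have ME x' : M x' @^-1` S = [set om | A true x' (z ^~ om)].
    by apply/seteqP; split => om /=; rewrite /A /M /=; case: dpdHSIC_test.
  by rewrite !ME; exact: key.
- have ME x' : M x' @^-1` S = [set om | A false x' (z ^~ om)].
    by apply/seteqP; split => om /=; rewrite /A /M /=; case: dpdHSIC_test.
  by rewrite !ME; exact: key.
- have ME x' : M x' @^-1` S = set0 by apply/seteqP; split => // om /=; case: (M x' om).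
  by rewrite !ME !measure0 mule0 add0e lee_fin.
Qed.

End privacy.

(** * The probability space of the test *)

Section experiment.
Context (R : realType) (d : nat) (X : 'I_d -> ptopologicalType)
  (P : probability (prod_space X) R)
  (dO : measure_display) (Om : measurableType dO) (Q : probability Om R)
  (n B : nat) (x : 'I_n -> {RV Q >-> prod_space X})
  (p : 'I_B -> Om -> {ffun 'I_d -> 'S_n}) (z : 'I_B.+1 -> {RV Q >-> R}).
Hypothesis e : dpdHSIC_experiment P x p z.

Local Notation perms := {ffun 'I_d -> 'S_n}.

Definition sources (s : 'I_n + 'I_B + 'I_B.+1) : set (set Om) :=
  match s with
  | inl (inl i) => Defs.generated (x i) measurable
  | inl (inr b) => Defs.generated (p b) setT
  | inr b => Defs.generated (z b) measurable
  end.

Lemma sources_independent : mutually_independent Q sources.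
Proof. exact: all_independent e. Qed.

Lemma sources_sigma s : sigma_algebra setT (sources s).
Proof.
case: s => [[i|b]|b]; apply: sigma_algebra_preimage.
- exact: sigma_algebra_measurable.
- by split.
- exact: sigma_algebra_measurable.
Qed.

Lemma measurable_permutation b (S : set perms) : measurable (p b @^-1` S).
Proof.
have -> : p b @^-1` S = \bigcup_(t in S) (p b @^-1` [set t]).
  by apply/seteqP; split => [om Som|om [t St /= ->]//]; exists (p b om).
apply: fin_bigcup_measurable; first exact: finite_finset.
by move=> t _; have [] := permutation_law e b t.
Qed.

Lemma sources_measurable s : sources s `<=` measurable.
Proof.
case: s => [[i|b]|b] /= A [C mC <-].
- exact: measurable_funP.
- by rewrite setTI; exact: measurable_permutation.
- exact: measurable_funP.
Qed.

(** An event of the sample and the noise, described by what makes it measurable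
    whatever measurable space carries them: the original one, the one where
    only sample and noise are observed, and the space of their values. *)
Definition data_event (A : ('I_n -> prod_space X) -> ('I_B.+1 -> R) -> Prop) :=
  forall (dT : measure_display) (T : measurableType dT)
    (u : 'I_n -> T -> prod_space X) (v : 'I_B.+1 -> T -> R),
  (forall i j, borel_measurable (fun t => u i t j)) ->
  (forall b, measurable_fun setT (v b)) ->
  measurable [set t | A (u ^~ t) (v ^~ t)].

Lemma measurable_data_event A : data_event A ->
  measurable [set om | A (x ^~ om) (z ^~ om)].
Proof. by move=> mA; apply: mA => // i j; exact: measurable_coordinate. Qed.

Let data_sources : {set 'I_n + 'I_B + 'I_B.+1} :=
  [set s | if s is inl (inr _) then false else true]%SET.

Let perm_sources : {set 'I_n + 'I_B + 'I_B.+1} :=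
  [set (inl (inr b) : 'I_n + 'I_B + 'I_B.+1) | b in [set: 'I_B]]%SET.

Lemma data_event_sources A : data_event A ->
  <<s \bigcup_(s in [set` data_sources]) sources s >>
    [set om | A (x ^~ om) (z ^~ om)].
Proof.
move=> mA; set G := \bigcup_(s in _) _.
apply: (mA _ (g_sigma_algebraType G)
  (fun i (t : g_sigma_algebraType G) => x i t) (fun b t => z b t)) => [i j|b].
  move=> C bC; apply: sub_sigma_algebra; exists (inl (inl i)); first by rewrite /= inE.
  exists [set y : prod_space X | C (y j)]; last by rewrite setTI.
  by apply: sub_sigma_algebra; exists j => //; exists C => //; rewrite setTI.
move=> _ C mC; rewrite setTI; apply: sub_sigma_algebra.
by exists (inr b); [rewrite /= inE|exists C => //; rewrite setTI].
Qed.

Let perm_event (q : {ffun 'I_B -> perms}) : set Om := [set om | forall b, p b om = q b].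

Let perm_eventE q : perm_event q = \bigcap_(s in [set` perm_sources])
  (if s is inl (inr b) then p b @^-1` [set q b] else setT).
Proof.
apply/seteqP; split => [om h s /=|om h b].
  by move=> /imsetP[b _ ->]; exact: h.
have := h (inl (inr b)); apply; rewrite /=; apply/imsetP.
by exists b => //; rewrite inE.
Qed.

Lemma prob_data_perm A (q : {ffun 'I_B -> perms}) : data_event A ->
  Q ([set om | A (x ^~ om) (z ^~ om)] `&` [set om | forall b, p b om = q b])
    = ((#|{ffun 'I_B -> perms}|%:R^-1)%:E * Q [set om | A (x ^~ om) (z ^~ om)])%E.
Proof.
move=> mA; rewrite -[X in _ `&` X]/(perm_event q) perm_eventE.
have D s : s \in perm_sources ->
    sources s (if s is inl (inr b) then p b @^-1` [set q b] else setT).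
  by move=> /imsetP[b _ ->]; exists [set q b] => //; rewrite setTI.
rewrite (independent_group sources_sigma sources_measurable sources_independent
  (J := data_sources))//; last 2 first.
- by move=> s /imsetP[b _ ->]; rewrite inE.
- exact: data_event_sources.
rewrite muleC sources_independent//; congr (_ * _)%E.
rewrite big_imset /=; last by move=> b c _ _ [].
rewrite (eq_bigr (fun=> (#|{: perms}|%:R^-1)%:E)) => [|b _]; last first.
  by have [_] := permutation_law e b (q b).
rewrite prodEFin prodr_const; congr EFin.
by rewrite cardsT [in RHS]card_ffun card_ord natrX exprVn.
Qed.

(** The permutations may be averaged out, because they are independent of
    sample and noise. *)
Lemma prob_average_perms (A : {ffun 'I_B -> perms} ->
    ('I_n -> prod_space X) -> ('I_B.+1 -> R) -> Prop) :
  (forall q, data_event (A q)) ->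
  measurable [set om | A [ffun b => p b om] (x ^~ om) (z ^~ om)] /\
  Q [set om | A [ffun b => p b om] (x ^~ om) (z ^~ om)]
    = (\sum_q (#|{ffun 'I_B -> perms}|%:R^-1)%:E * Q [set om | A q (x ^~ om) (z ^~ om)])%E.
Proof.
move=> mA.
pose E q := [set om | A q (x ^~ om) (z ^~ om)] `&` perm_event q.
have mE q : measurable (E q).
  apply: measurableI; first exact: measurable_data_event.
  rewrite perm_eventE; apply: measurable_bigcap_finite => s /imsetP[b _ ->].
  exact: measurable_permutation.
have -> : [set om | A [ffun b => p b om] (x ^~ om) (z ^~ om)]
    = \bigcup_(q in [set: {ffun 'I_B -> perms}]) E q.
  apply/seteqP; split => [om h|om [q _ [h pq]]].
    by exists [ffun b => p b om] => //; split => // b; rewrite ffunE.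
  by rewrite /= (_ : [ffun b => _] = q)//; apply/ffunP => b; rewrite ffunE.
have finT : finite_set [set: {ffun 'I_B -> perms}] by exact: finite_finset.
split; first exact: fin_bigcup_measurable.
rewrite measure_fin_bigcup//.
  rewrite fsbig_finite//= (perm_big (index_enum {ffun 'I_B -> perms})) /=.
    by apply: eq_bigr => q _; exact: prob_data_perm.
  apply: uniq_perm; [exact: finmap.fset_uniq|exact: index_enum_uniq|].
  by move=> q; rewrite in_fset_set// mem_index_enum; exact/mem_set.
apply/trivIsetP => q q' _ _ /eqP qq'; apply/seteqP; split => // om [[_ h] [_ h']].
by case: qq'; apply/ffunP => b; rewrite -h -h'.
Qed.

End experiment.

(** * Validity *)

Section null_invariance.
Context (R : realType) (d : nat) (X : 'I_d -> ptopologicalType)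
  (P : probability (prod_space X) R)
  (dO : measure_display) (Om : measurableType dO) (Q : probability Om R)
  (n B : nat) (x : 'I_n -> {RV Q >-> prod_space X})
  (p : 'I_B -> Om -> {ffun 'I_d -> 'S_n}) (z : 'I_B.+1 -> {RV Q >-> R}).
Hypothesis e : dpdHSIC_experiment P x p z.
Hypothesis P_null : product_of_marginals P.

Let W : pointedType := (('I_n -> prod_space X) * ('I_B.+1 -> R))%type.

Let box (A : 'I_n -> forall j, set (X j)) (C : 'I_B.+1 -> set R) : set W :=
  [set w | (forall i j, A i j (w.1 i j)) /\ (forall b, C b (w.2 b))].

Let boxes : set (set W) := [set S | exists (A : 'I_n -> forall j, set (X j)) C,
  [/\ forall i j, borel (X j) (A i j), forall b, measurable (C b) & S = box A C]].

Let borelT j : borel (X j) setT.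
Proof. by apply: sub_sigma_algebra; exact: openT. Qed.

Let borelI j : setI_closed (borel (X j)).
Proof. exact: (@measurableI _ (g_sigma_algebraType (@open (X j)))). Qed.

Let boxesI : setI_closed boxes.
Proof.
move=> _ _ [A [C [bA mC ->]]] [A' [C' [bA' mC' ->]]].
exists (fun i j => A i j `&` A' i j), (fun b => C b `&` C' b); split.
- by move=> i j; exact: borelI.
- by move=> b; exact: measurableI.
- apply/seteqP; split => [w [[hA hC] [hA' hC']]|w [h h']]; first by split=> *; split.
  by split; split => [i j|b]; [case: (h i j)|case: (h' b)|case: (h i j)|case: (h' b)].
Qed.

Let rearranged (sigma : {ffun 'I_d -> 'S_n}) (tau : 'S_B.+1) (om : Om) :
    g_sigma_algebraType boxes :=
  (permute (x ^~ om) sigma, fun b => z (tau b) om).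

Let piece (A : 'I_n -> forall j, set (X j)) (C : 'I_B.+1 -> set R)
    (sigma : {ffun 'I_d -> 'S_n}) (tau : 'S_B.+1)
    (s : 'I_n + 'I_B + 'I_B.+1) : set Om :=
  match s with
  | inl (inl i) => x i @^-1` [set y | forall j, A ((sigma j)^-1%g i) j (y j)]
  | inl (inr b) => setT
  | inr b => z b @^-1` C ((tau^-1)%g b)
  end.

Let rearranged_box A C sigma tau : rearranged sigma tau @^-1` box A C
  = \bigcap_(s in [set` [set: 'I_n + 'I_B + 'I_B.+1]%SET]) piece A C sigma tau s.
Proof.
apply/seteqP; split => [om [hA hC] [[i|b]|b] _ //=|om h].
- by move=> j; have := hA ((sigma j)^-1%g i) j; rewrite /rearranged /permute /= permKV.
- by have := hC ((tau^-1)%g b); rewrite /= permKV.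
split => [i j|b] /=.
  by have := h (inl (inl (sigma j i))); rewrite /= inE => /(_ erefl j); rewrite permK.
by have := h (inr (tau b)); rewrite /= inE => /(_ erefl); rewrite permK.
Qed.

Let piece_sources A C sigma tau s : (forall i j, borel (X j) (A i j)) ->
  (forall b, measurable (C b)) -> sources x p z s (piece A C sigma tau s).
Proof.
move=> bA mC; case: s => [[i|b]|b] /=.
- exists [set y : prod_space X | forall j, A ((sigma j)^-1%g i) j (y j)]; last by rewrite setTI.
  by apply: (measurable_columns (A := fun j => A ((sigma j)^-1%g i) j)) => j.
- by exists setT => //; rewrite setTI.
- by exists (C ((tau^-1)%g b)) => //; rewrite setTI.
Qed.

Let prob_box A C sigma tau : (forall i j, borel (X j) (A i j)) ->
  (forall b, measurable (C b)) ->
  Q (rearranged sigma tau @^-1` box A C)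
    = ((\prod_(j < d) \prod_(i < n) marginal P (A i j)) *
       \prod_(b < B.+1) laplace_prob (C b))%E.
Proof.
move=> bA mC; rewrite rearranged_box (sources_independent e); last first.
  by move=> s _; exact: piece_sources.
rewrite big_sumType big_sumType /= [X in (_ * X * _)%E]big1 => [|b _]; last first.
  exact: probability_setT.
rewrite mule1; congr (_ * _)%E.
  rewrite (eq_bigl xpredT) => [|i]; last by rewrite inE.
  rewrite (eq_bigr (fun i => \prod_(j < d) marginal P (A ((sigma j)^-1%g i) j))%E) => [|i _].
    rewrite exchange_big /=; apply: eq_bigr => j _.
    by rewrite [RHS](reindex_inj (@perm_inj _ ((sigma j)^-1)%g)).
  have mA := @measurable_columns d X (fun j => A ((sigma j)^-1%g i) j) (fun j => bA _ j).
  by rewrite -P_null// -(sample_law e i mA).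
rewrite (eq_bigl xpredT) => [|i]; last by rewrite inE.
rewrite [RHS](reindex_inj (@perm_inj _ (tau^-1)%g)); apply: eq_bigr => b _.
exact: (noise_law e b (mC _)).
Qed.

Let measurable_rearranged sigma tau : measurable_fun setT (rearranged sigma tau).
Proof.
apply: (@measurability _ _ _ (g_sigma_algebraType boxes) _ _ boxes) => //.
move=> _ [_ [A [C [bA mC ->]]] <-]; rewrite setTI rearranged_box.
apply: measurable_bigcap_finite => s _.
by apply: (sources_measurable e (s := s)); exact: piece_sources.
Qed.

(** Under the null, the coordinates of the sample are independent with laws
    that depend on the column only, and the noise is i.i.d.; the boxes form a
    pi-system on which rearranging columns and noise changes nothing. *)
Lemma null_rearrangement (A : ('I_n -> prod_space X) -> ('I_B.+1 -> R) -> Prop)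
    (sigma : {ffun 'I_d -> 'S_n}) (tau : 'S_B.+1) :
  data_event A ->
  Q [set om | A (permute (x ^~ om) sigma) (fun b => z (tau b) om)]
    = Q [set om | A (x ^~ om) (z ^~ om)].
Proof.
move=> mA.
have mS : measurable ([set w | A w.1 w.2] : set (g_sigma_algebraType boxes)).
  apply: (mA _ (g_sigma_algebraType boxes) (fun i w => w.1 i) (fun b w => w.2 b)) => [i j|b].
    move=> D bD; apply: sub_sigma_algebra.
    pose only_j := @eqtype.dfwith 'I_d (fun l => set (X l)) (fun l => setT) j D.
    exists (fun i' => if i' == i then only_j else fun l => setT), (fun=> setT).
    split => //.
      by move=> i' j'; case: eqVneq => // _; rewrite /only_j; case: eqtype.dfwithP.
    apply/seteqP; split => [w Dw|w [h _]]; last first.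
      by have := h i j; rewrite eqxx /only_j /= dfwith_in.
    by split => // i' j'; case: eqVneq => // ->; rewrite /only_j; case: eqtype.dfwithP.
  move=> _ D mD; rewrite setTI; apply: sub_sigma_algebra.
  exists (fun i j => setT), (fun b' => if b' == b then D else setT).
  split => //; first by move=> b'; case: ifP.
  apply/seteqP; split => [w Dw|w [_ /(_ b)]]; last by rewrite eqxx.
  by split => // b'; case: eqVneq => // ->.
have boxT : boxes setT.
  by exists (fun i j => setT), (fun=> setT); split => //; apply/seteqP; split.
have same D : boxes D -> Q (rearranged sigma tau @^-1` D)
    = Q (rearranged [ffun=> 1%g] 1%g @^-1` D).
  by move=> [A' [C' [bA' mC' ->]]]; rewrite !prob_box.
transitivity (Q (rearranged [ffun=> 1%g] 1%g @^-1` [set w | A w.1 w.2])).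
  exact: (law_unique (measurable_rearranged sigma tau)
    (measurable_rearranged [ffun=> 1%g] 1%g) boxesI boxT same mS).
congr (Q _); apply/funext => om; rewrite /preimage /rearranged /=; congr (A _ _).
  exact: permute_identity.
by apply/funext => b; rewrite perm1.
Qed.

End null_invariance.

Section validity.
Context (R : realType) (d : nat) (X : 'I_d -> ptopologicalType).
Context (X_separable : forall j, separable (X j)).
Context (k : forall j, X j -> X j -> R).
Arguments k : clear implicits.
Context (k_continuous : forall j, continuous (fun u : X j * X j => k j u.1 u.2))
  (k_psd : forall j, psd_kernel (k j))
  (K : 'I_d -> R) (k_bounds : forall j x y, 0 <= k j x y <= K j)
  (H : rkhs (tensor_kernel k)) (alpha eps del : R) (alpha0 : 0 <= alpha).
Context (n B : nat).
Local Notation perms := {ffun 'I_d -> 'S_n}.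

Definition indexed_statistic (rho : 'I_B.+1 -> perms)
    (u : 'I_n -> prod_space X) (v : 'I_B.+1 -> R) (b : 'I_B.+1) : R :=
  dHSIC H (permute u (rho b))
    + 2 * sensitivity K n * (privacy_level eps del)^-1 * v b.

Lemma measurable_permuted_dHSIC (dT : measure_display) (T : measurableType dT)
    (u : 'I_n -> T -> prod_space X) (rho : perms) :
  (forall i j, borel_measurable (fun t => u i t j)) ->
  measurable_fun setT (fun t => dHSIC H (permute (u ^~ t) rho)).
Proof.
move=> mu.
apply: (measurable_dHSIC X_separable k_continuous k_psd k_bounds H
  (x := fun i t => permute (u ^~ t) rho i)).
by move=> i j; exact: mu.
Qed.

Lemma measurable_indexed_statistic (dT : measure_display) (T : measurableType dT)
    (u : 'I_n -> T -> prod_space X) (v : 'I_B.+1 -> T -> R) rho b :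
  (forall i j, borel_measurable (fun t => u i t j)) ->
  (forall b, measurable_fun setT (v b)) ->
  measurable_fun setT (fun t => indexed_statistic rho (u ^~ t) (v ^~ t) b).
Proof.
move=> mu mv; apply: measurable_funD; first exact: measurable_permuted_dHSIC.
exact: measurable_funM.
Qed.

Definition rejects_index (rho : 'I_B.+1 -> perms) (c : 'I_B.+1)
    (u : 'I_n -> prod_space X) (v : 'I_B.+1 -> R) : Prop :=
  rank_pvalue (indexed_statistic rho u v) c <= alpha.

Lemma data_event_rejects rho c : data_event (rejects_index rho c).
Proof.
move=> dT T u v mu mv.
apply: (measurable_rank_pvalue (M := fun b t => indexed_statistic rho (u ^~ t) (v ^~ t) b)) => b.
exact: measurable_indexed_statistic.
Qed.

Lemma test_rejects_index u (q : 'I_B -> perms) v :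
  dpdHSIC_test H K alpha eps del u q v = (rank_pvalue (indexed_statistic (with_identity q) u v) ord0 <= alpha).
Proof. exact: dpdHSIC_testE. Qed.

Context (P : probability (prod_space X) R)
  (dO : measure_display) (Om : measurableType dO) (Q : probability Om R)
  (x : 'I_n -> {RV Q >-> prod_space X})
  (p : 'I_B -> Om -> {ffun 'I_d -> 'S_n}) (z : 'I_B.+1 -> {RV Q >-> R}).
Hypothesis e : dpdHSIC_experiment P x p z.

Lemma test_eventE :
  [set om | dpdHSIC_test H K alpha eps del (x ^~ om) (p ^~ om) (z ^~ om)]
    = [set om | rejects_index (with_identity [ffun b => p b om]) ord0
        (x ^~ om) (z ^~ om)].
Proof.
apply/funext => om; rewrite /mkset test_rejects_index /rejects_index.
suff -> : [ffun b => p b om] = (p ^~ om) :> ('I_B -> perms) by [].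
by apply/funext => b; rewrite ffunE.
Qed.

Lemma expected_testE :
  measurable [set om | dpdHSIC_test H K alpha eps del (x ^~ om) (p ^~ om) (z ^~ om)] /\
  expected_test H K alpha eps del x p z
    = Q [set om | dpdHSIC_test H K alpha eps del (x ^~ om) (p ^~ om) (z ^~ om)].
Proof.
set S := [set om | _].
have mS : measurable S.
  rewrite /S test_eventE.
  by have [] := prob_average_perms e
    (fun q : {ffun 'I_B -> perms} => data_event_rejects (with_identity q) ord0).
split => //; rewrite /expected_test -expectation_indic//; congr expectation.
apply/funext => om; rewrite indicE; congr ((nat_of_bool _)%:R).
by apply/idP/idP => [h|/set_mem]; [exact/mem_set|].
Qed.

Hypothesis P_null : product_of_marginals P.

Let g (rho : 'I_B.+1 -> perms) (c : 'I_B.+1) : R :=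
  fine (Q [set om | rejects_index rho c (x ^~ om) (z ^~ om)]).

Let gE rho c : Q [set om | rejects_index rho c (x ^~ om) (z ^~ om)] = (g rho c)%:E.
Proof.
rewrite /g fineK// fin_num_measure//.
exact: (measurable_data_event x z (@data_event_rejects rho c)).
Qed.

Let g_translate (sigma : perms) rho c : g (fun b => compose_perms sigma (rho b)) c = g rho c.
Proof.
rewrite /g -(null_rearrangement e P_null sigma 1%g (@data_event_rejects rho c)).
congr (fine (Q _)); apply/funext => om; rewrite /mkset /rejects_index.
suff -> : indexed_statistic (fun b => compose_perms sigma (rho b)) (x ^~ om) (z ^~ om)
    = indexed_statistic rho (permute (x ^~ om) sigma) (fun b => z ((1%g : 'S_B.+1) b) om) by [].
by apply/funext => b; rewrite /indexed_statistic permute_compose perm1.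
Qed.

Let g_swap (tau : 'S_B.+1) rho c : g (fun b => rho (tau b)) c = g rho (tau c).
Proof.
rewrite /g -(null_rearrangement e P_null [ffun=> 1%g] tau
  (@data_event_rejects (fun b => rho (tau b)) c)).
congr (fine (Q _)); apply/funext => om; rewrite /mkset /rejects_index.
rewrite permute_identity.
suff -> : rank_pvalue (indexed_statistic (fun b => rho (tau b)) (x ^~ om)
    (fun b => z (tau b) om)) c
  = rank_pvalue (indexed_statistic rho (x ^~ om) (z ^~ om)) (tau c) by [].
by rewrite /rank_pvalue [in RHS](reindex_inj (@perm_inj _ tau)).
Qed.

Let sum_g_le rho : \sum_c g rho c <= alpha * B.+1%:R.
Proof.
pose S c := [set om | rejects_index rho c (x ^~ om) (z ^~ om)].
have mS c : measurable (S c) by exact: (measurable_data_event x z (@data_event_rejects rho c)).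
have bS c := bounded_variable_indic R (mS c).
have -> : \sum_c g rho c = \int[Q]_om (\sum_c (\1_(S c) om : R)).
  by rewrite mean_sum//; apply: eq_bigr => c _; rewrite mean_indic.
rewrite -[leRHS](mean_cst Q); apply: mean_le.
- exact: bounded_variable_sum.
- exact: bounded_variable_cst.
move=> om; apply: le_trans (sum_rank_pvalue_le (indexed_statistic rho (x ^~ om) (z ^~ om)) alpha0).
apply: ler_sum => c _; rewrite indicE ler_nat.
by case: (boolP (om \in S c)) => // /set_mem; rewrite /S /= /rejects_index => ->.
Qed.

Let N : R := #|{: perms}|%:R.

(** Averaging over a common translation of the tuples makes the identity a
    uniform permutation, and then all indices are exchangeable. *)
Let sum_g_identity :
  \sum_(q : {ffun 'I_B -> perms}) g (with_identity q) ord0 <= alpha * N ^+ B.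
Proof.
have Np : 0 < N by rewrite ltr0n; apply/card_gt0P; exists [ffun=> 1%g].
pose S := \sum_(rho : {ffun 'I_B.+1 -> perms}) g rho ord0.
have S_le : S <= alpha * N ^+ B.+1.
  have Sc c : S = \sum_(rho : {ffun 'I_B.+1 -> perms}) g rho c.
    pose f (rho : {ffun 'I_B.+1 -> perms}) : {ffun 'I_B.+1 -> perms} :=
      [ffun b => rho (tperm ord0 c b)].
    have fK : involutive f by move=> rho; apply/ffunP => b; rewrite !ffunE tpermK.
    rewrite /S (reindex_inj (inv_inj fK)) /=; apply: eq_bigr => rho _.
    have -> : (f rho : 'I_B.+1 -> perms) = (fun b => rho (tperm ord0 c b)).
      by apply/funext => b; rewrite ffunE.
    by rewrite g_swap tpermL.
  have : \sum_(c < B.+1) S <= N ^+ B.+1 * (alpha * B.+1%:R).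
    rewrite (eq_bigr (fun c => \sum_(rho : {ffun 'I_B.+1 -> perms}) g rho c)) => [|c _]; last exact: Sc.
    rewrite exchange_big /=.
    apply: le_trans (ler_sum _ (fun rho _ => sum_g_le _)) _.
    by rewrite sumr_const card_ffun card_ord -[leLHS]mulr_natl natrX.
  rewrite sumr_const card_ord -[leLHS]mulr_natr mulrA ler_pM2r ?ltr0n//.
  by rewrite mulrC.
suff SE : S = N * \sum_(q : {ffun 'I_B -> perms}) g (with_identity q) ord0.
  by move: S_le; rewrite SE exprS mulrCA ler_pM2l.
pose f (sq : perms * {ffun 'I_B -> perms}) : {ffun 'I_B.+1 -> perms} :=
  [ffun b => compose_perms sq.1 (with_identity sq.2 b)].
have f0 sq : f sq ord0 = sq.1.
  by rewrite ffunE /with_identity unlift_none; apply/ffunP => j; rewrite !ffunE mul1g.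
have fS sq c : f sq (lift ord0 c) = compose_perms sq.1 (sq.2 c).
  by rewrite ffunE /with_identity liftK.
have f_inj : injective f.
  move=> [s q] [s' q'] ff; have ss' : s = s' by have := f0 (s, q); rewrite ff f0.
  subst s'; congr pair; apply/ffunP => c.
  have := fS (s, q) c; rewrite ff fS /= => /ffunP h.
  by apply/ffunP => j; have := h j; rewrite !ffunE => /mulIg.
have f_bij : bijective f.
  apply: (inj_card_bij f_inj).
  by rewrite card_prod !(card_ffun (fintype_ordinal__canonical__fintype_Finite _) perms) !card_ord expnS.
have [f' fK f'K] := f_bij.
rewrite /S (reindex f) /=; last by apply: onW_bij.
rewrite -(pair_big xpredT xpredT (fun s q => g (f (s, q)) ord0)) /=.
rewrite (eq_bigr (fun=> \sum_(q : {ffun 'I_B -> perms}) g (with_identity q) ord0)) => [|s _].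
  by rewrite sumr_const mulr_natl.
apply: eq_bigr => q _; rewrite -[RHS](g_translate s).
suff -> : (f (s, q) : 'I_B.+1 -> perms) = (fun b => compose_perms s (with_identity q b)) by [].
by apply/funext => b; rewrite ffunE.
Qed.

Lemma dpdHSIC_valid : (expected_test H K alpha eps del x p z <= alpha%:E)%E.
Proof.
have [_ ->] := expected_testE; rewrite test_eventE.
have [_ ->] := prob_average_perms e
  (fun q : {ffun 'I_B -> perms} => data_event_rejects (with_identity q) ord0).
under eq_bigr do rewrite gE -EFinM.
rewrite sumEFin lee_fin -mulr_sumr mulrC.
rewrite ler_pdivrMr; last by rewrite ltr0n; apply/card_gt0P; exists [ffun=> [ffun=> 1%g]].
by apply: le_trans sum_g_identity _; rewrite card_ffun card_ord natrX.
Qed.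

End validity.

(** * Means of products and separation of the alternative *)

Section product_means.
Context (R : realType) (dO : measure_display) (Om : measurableType dO)
  (Q : probability Om R) (I : finType) (F : I -> set (set Om)).
Hypotheses (F_sigma : forall i, sigma_algebra setT (F i))
  (F_meas : forall i, F i `<=` measurable) (F_indep : mutually_independent Q F).

(** Induction on the number of factors: the product of the previous factors is
    measurable for the sigma-algebra that their sources generate, of which the
    source of the next factor is independent. *)
Lemma mean_prod_independent (J : eqType) (r : seq J) (f : J -> I)
    (g : J -> Om -> R) : injective f -> uniq r ->
  (forall j, bounded_variable (g j)) -> (forall j om, 0 <= g j om) ->
  (forall j C, measurable C -> F (f j) (g j @^-1` C)) ->
  \int[Q]_om (\prod_(j <- r) g j om) = \prod_(j <- r) \int[Q]_om g j om.
Proof.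
move=> f_inj + bg g0 gF; elim: r => [_|j r IH /= /andP[jr ur]].
  by under eq_Rintegral do rewrite big_nil; rewrite mean_cst big_nil.
under eq_Rintegral do rewrite big_cons mulrC.
rewrite big_cons -IH// mulrC; apply: mean_mul_independent => //.
- exact: bounded_variable_prod.
- by move=> om; apply: prodr_ge0.
move=> A C mA mC.
have SjE : \bigcap_(i in [set` [set f j]%SET]) (g j @^-1` C) = g j @^-1` C.
  apply/seteqP; split => [om /(_ (f j))|om h i _] //.
  by apply; rewrite /= inE.
have := @independent_group _ _ _ Q _ _ F_sigma F_meas F_indep
  [set i in [seq f l | l <- r]]%SET [set f j]%SET
  ((fun om => \prod_(l <- r) g l om) @^-1` A) (fun=> g j @^-1` C).
rewrite SjE; apply.
- move=> i; rewrite !inE => /eqP ->; apply: contra jr.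
  by rewrite (mem_map f_inj).
- set G := \bigcup_(i in _) _.
  have : measurable_fun setT ((fun om => \prod_(l <- r) g l om) : g_sigma_algebraType G -> R).
    apply: measurable_prod => l lr _ D mD; rewrite setTI; apply: sub_sigma_algebra.
    by exists (f l); [rewrite /= inE map_f|exact: gF].
  by move=> /(_ measurableT _ mA); rewrite setTI.
- by move=> i; rewrite inE => /eqP ->; exact: gF.
Qed.

End product_means.

Section sample_means.
Context (R : realType) (d : nat) (X : 'I_d -> ptopologicalType)
  (P : probability (prod_space X) R)
  (dO : measure_display) (Om : measurableType dO) (Q : probability Om R)
  (n B : nat) (x : 'I_n -> {RV Q >-> prod_space X})
  (p : 'I_B -> Om -> {ffun 'I_d -> 'S_n}) (z : 'I_B.+1 -> {RV Q >-> R}).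
Hypothesis e : dpdHSIC_experiment P x p z.

Lemma mean_sample (g : prod_space X -> R) i : measurable_fun setT g ->
  (forall y, 0 <= g y) -> \int[Q]_om g (x i om) = \int[P]_y g y.
Proof.
move=> mg g0; rewrite /Rintegral; congr fine.
transitivity (\int[distribution Q (x i)]_y (g y)%:E)%E.
  by rewrite ge0_integral_distribution//; exact/measurable_EFinP.
apply: eq_measure_integral => A mA _; exact: (sample_law e).
Qed.

Lemma mean_prod_sample (g : 'I_n -> prod_space X -> R) (M : R) (r : seq 'I_n) :
  uniq r -> (forall i, measurable_fun setT (g i)) ->
  (forall i y, 0 <= g i y <= M) ->
  \int[Q]_om (\prod_(i <- r) g i (x i om)) = \prod_(i <- r) \int[P]_y g i y.
Proof.
move=> ur mg gM.
have g0 i y : 0 <= g i y by case/andP: (gM i y).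
rewrite (mean_prod_independent (sources_sigma x p z) (sources_measurable e)
  (sources_independent e) (f := fun i => inl (inl i)) (g := fun i om => g i (x i om)))//.
- by apply: eq_bigr => i _; exact: mean_sample.
- by move=> i i' [].
- move=> i; split; first exact: measurableT_comp.
  by exists M => om; rewrite ger0_norm//; case/andP: (gM i (x i om)).
- move=> i C mC; exists (g i @^-1` C); last by rewrite setTI.
  by rewrite -[X in measurable X]setTI; exact: mg.
Qed.

Lemma sample_average_deviation (g : prod_space X -> R) (M eta : R) :
  (0 < n)%N -> 0 < eta -> measurable_fun setT g -> (forall y, 0 <= g y <= M) ->
  (Q [set om | (eta <= `|n%:R^-1 * \sum_(i < n) g (x i om) - \int[P]_y g y|)%R]
     <= (M ^+ 2 / (n%:R * eta ^+ 2))%:E)%E.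
Proof.
move=> n0 eta0 mg gM; have g0 y : 0 <= g y by case/andP: (gM y).
apply: (average_deviation (g := fun i om => g (x i om))) => //.
- by move=> i; exact: measurableT_comp.
- by move=> i; exact: mean_sample.
move=> i l il.
have := @mean_prod_sample (fun=> g) M [:: i; l].
rewrite !big_cons !big_nil mulr1 => <- //; last by rewrite /= inE il.
by apply: eq_Rintegral => om _; rewrite !big_cons big_nil mulr1.
Qed.

End sample_means.

Section identification.
Context (R : realType) (d : nat) (X : 'I_d -> ptopologicalType).
Context (X_separable : forall j, separable (X j)).
Context (k : forall j, X j -> X j -> R).
Arguments k : clear implicits.
Context (k_continuous : forall j, continuous (fun u : X j * X j => k j u.1 u.2))
  (k_psd : forall j, psd_kernel (k j))
  (K : 'I_d -> R) (k_bounds : forall j x y, 0 <= k j x y <= K j).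
Context (k_characteristic :
     characteristic_kernel (tensor_kernel k : prod_space X -> prod_space X -> R)).

Lemma measurable_section j (a : X j) :
  measurable_fun setT (fun w : prod_space X => k j (w j) a).
Proof.
apply: (@measurable_psd_kernel _ _ (k j) (K j)) => //.
  exact: measurable_projection.
by move=> A _; rewrite preimage_cst; case: ifP.
Qed.

Lemma measurable_tensor_section (y : prod_space X) :
  measurable_fun setT (fun w : prod_space X => tensor_kernel k w y).
Proof. by apply: measurable_prod => j _; exact: measurable_section. Qed.

(** In a sample of size [d], the point whose coordinate [j] is that of
    observation [j] has the product of the marginals as its law.  If the two
    sides agreed for all [y], this law and [P] would have the same mean
    embedding. *)
Lemma alternative_separated (P : probability (prod_space X) R)
  (dO : measure_display) (Om : measurableType dO) (Q : probability Om R)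
  (B : nat) (x : 'I_d -> {RV Q >-> prod_space X})
  (p : 'I_B -> Om -> {ffun 'I_d -> 'S_d}) (z : 'I_B.+1 -> {RV Q >-> R}) :
  dpdHSIC_experiment P x p z -> ~ product_of_marginals P ->
  exists y : prod_space X, \int[P]_w tensor_kernel k w y
    != \prod_j \int[P]_w k j (w j) (y j).
Proof.
move=> e; apply: contra_notP => /forallNP same.
pose Y : Om -> prod_space X := fun om j => x j om j.
have mY : measurable_fun setT Y.
  apply: (@measurability _ _ _ (prod_space X) _ _ (cylinders X)) => //.
  move=> _ [_ [j _ [A bA <-]] <-]; rewrite !setTI.
  exact: (measurable_coordinate (measurable_funPT (x j)) bA).
pose Yrv : {mfun Om >-> prod_space X} :=
  HB.pack Y (isMeasurableFun.Build _ _ _ _ Y mY).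
have embE : mean_embedding (tensor_kernel k : prod_space X -> prod_space X -> R) P
    =1 mean_embedding (tensor_kernel k : prod_space X -> prod_space X -> R) (distribution Q Yrv).
  move=> y; rewrite /mean_embedding; have /negP/negPn/eqP -> := same y.
  transitivity (\int[Q]_om tensor_kernel k (Y om) y); last first.
    rewrite /Rintegral; congr fine; rewrite ge0_integral_distribution//.
      by apply/measurable_EFinP; exact: measurable_tensor_section.
    by move=> w; rewrite lee_fin prodr_ge0// => j _; exact: (kernel_ge0 k_bounds).
  rewrite /tensor_kernel /Y.
  have K_le j : K j <= \sum_l K l.
    by rewrite (bigD1 j)//= lerDl sumr_ge0// => l _; exact: (bound_ge0 k_bounds).
  rewrite (mean_prod_sample e (g := fun j w => k j (w j) (y j)) (M := \sum_j K j))//.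
  - exact: index_enum_uniq.
  - by move=> j; exact: measurable_section.
  - by move=> j w; case/andP: (k_bounds (w j) (y j)) => -> /le_trans ->.
have lawE := k_characteristic embE.
move=> A bA; rewrite lawE; last exact: measurable_columns.
pose D (s : 'I_d + 'I_B + 'I_B.+1) : set Om :=
  if s is inl (inl j) then x j @^-1` [set w : prod_space X | A j (w j)] else setT.
rewrite [LHS](_ : _ = Q (\bigcap_(s in [set` [set: 'I_d + 'I_B + 'I_B.+1]%SET]) D s)); last first.
  congr (Q _); apply/seteqP; split => [om h [[j|b]|b] _ //=|om h j].
  by have := h (inl (inl j)); rewrite /= inE; apply.
rewrite (sources_independent e) => [|[[j|b]|b] _ /=]; last 3 first.
- exists [set w : prod_space X | A j (w j)]; last by rewrite setTI.
  exact: (measurable_projection (bA j)).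
- by exists setT => //; rewrite setTI.
- by exists setT => //; rewrite setTI.
rewrite big_sumType big_sumType /= [X in (_ * X * _)%E]big1 => [|b _]; last exact: probability_setT.
rewrite [X in (_ * X)%E]big1 => [|b _]; last exact: probability_setT.
rewrite !mule1 (eq_bigl xpredT) => [|j]; last by rewrite inE.
apply: eq_bigr => j _; apply: (sample_law e).
exact: (measurable_projection (bA j)).
Qed.

End identification.

(** * Probability bounds for the observed and the permuted statistic *)

Section consistency_bounds.
Context (R : realType) (d : nat) (X : 'I_d -> ptopologicalType).
Context (X_separable : forall j, separable (X j)).
Context (k : forall j, X j -> X j -> R).
Arguments k : clear implicits.
Context (k_continuous : forall j, continuous (fun u : X j * X j => k j u.1 u.2))
  (k_psd : forall j, psd_kernel (k j))
  (K : 'I_d -> R) (k_bounds : forall j x y, 0 <= k j x y <= K j)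
  (H : rkhs (tensor_kernel k)).
Local Notation K0 := (\prod_(j < d) K j).

(** The factors [1 + c j] are at least 1, so that one product bounds all the
    partial products of the telescoping sum. *)
Lemma prod_difference_le (a b c : 'I_d -> R) :
  (forall j, 0 <= a j <= c j) -> (forall j, 0 <= b j <= c j) ->
  `|\prod_j a j - \prod_j b j| <= (\prod_j (1 + c j)) * \sum_j `|a j - b j|.
Proof.
move=> ha hb.
have c0 j : 0 <= c j by case/andP: (ha j) => /le_trans; apply.
have c1 (r : seq 'I_d) : 1 <= \prod_(j <- r) (1 + c j).
  by elim/big_ind: _ => // [u v u1 v1|j _]; [exact: mulr_ege1|rewrite lerDl].
elim: (index_enum 'I_d) => [|j r IH]; first by rewrite !big_nil subrr normr0 mulr0.
rewrite !big_cons.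
set A := \prod_(i <- r) a i in IH *; set A' := \prod_(i <- r) b i in IH *.
set C := \prod_(i <- r) (1 + c i) in IH *; set S := \sum_(i <- r) _ in IH *.
have A0 : 0 <= A by apply: prodr_ge0 => i _; case/andP: (ha i).
have AC : A <= C.
  apply: ler_prod => i _; have /andP[-> /le_trans] := ha i; apply.
  by rewrite lerDr.
have S0 : 0 <= S by apply: sumr_ge0.
rewrite (_ : a j * A - b j * A' = (a j - b j) * A + b j * (A - A')); last by ring.
apply: le_trans (ler_normD _ _) _; rewrite !normrM (ger0_norm A0).
have /andP[b0 bc] := hb j; rewrite (ger0_norm b0) mulrDr lerD//.
  apply: (@le_trans _ _ (`|a j - b j| * C)); first by rewrite ler_wpM2l.
  rewrite mulrC ler_wpM2r// -[leLHS]mul1r ler_wpM2r ?lerDl//.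
  exact: le_trans ler01 (c1 r).
apply: (@le_trans _ _ (b j * (C * S))); first by rewrite ler_wpM2l.
rewrite mulrA ler_wpM2r// ler_wpM2r ?(le_trans ler01 (c1 r))//.
by apply: le_trans bc _; rewrite lerDr.
Qed.

Context (P : probability (prod_space X) R)
  (dO : measure_display) (Om : measurableType dO) (Q : probability Om R)
  (n B : nat) (x : 'I_n -> {RV Q >-> prod_space X})
  (p : 'I_B -> Om -> {ffun 'I_d -> 'S_n}) (z : 'I_B.+1 -> {RV Q >-> R}).
Hypothesis e : dpdHSIC_experiment P x p z.
Local Notation perms := {ffun 'I_d -> 'S_n}.

Definition permuted_second_moment_bound (m : nat) : R :=
  K0 * (m%:R^-1 + ((m%:R / m.-1%:R) ^+ d - 1)).

Lemma measurable_dHSIC_sample (rho : perms) :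
  measurable_fun setT (fun om => dHSIC H (permute (x ^~ om) rho)).
Proof.
apply: (measurable_permuted_dHSIC X_separable k_continuous k_psd k_bounds H
  (u := fun i om => x i om)).
by move=> i j; exact: measurable_coordinate.
Qed.

(** For every fixed data set, Markov's inequality over the permutations. *)
Lemma prob_permuted_large (b : 'I_B) (t : R) : (2 <= n)%N -> 0 < t ->
  measurable [set om | t <= dHSIC H (permute (x ^~ om) (p b om))] /\
  fine (Q [set om | t <= dHSIC H (permute (x ^~ om) (p b om))])
    <= permuted_second_moment_bound n / t ^+ 2.
Proof.
move=> n2 t0.
pose A (q : {ffun 'I_B -> perms}) (u : 'I_n -> prod_space X) (v : 'I_B.+1 -> R) : Prop :=
  t <= dHSIC H (permute u (q b)).
have mA q : data_event (A q).
  move=> dT T u v mu mv; rewrite -[X in measurable X]setTI.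
  apply: (@measurable_fun_le _ _ R setT (cst t)) => //.
  exact: (measurable_permuted_dHSIC X_separable k_continuous k_psd k_bounds H).
have [] := prob_average_perms e mA.
have -> : [set om | A [ffun b0 => p b0 om] (x ^~ om) (z ^~ om)]
    = [set om | t <= dHSIC H (permute (x ^~ om) (p b om))].
  by apply/funext => om; rewrite /mkset /A ffunE.
move=> mS ->; split => //.
pose S q := [set om | A q (x ^~ om) (z ^~ om)].
have mSq q : measurable (S q) by exact: (measurable_data_event x z (mA q)).
rewrite (eq_bigr (fun q => (#|{ffun 'I_B -> perms}|%:R^-1 * fine (Q (S q)))%:E)) => [|q _]; last first.
  by rewrite EFinM fineK// fin_num_measure.
rewrite sumEFin /= -mulr_sumr.
have Np : 0 < #|{ffun 'I_B -> perms}|%:R :> R.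
  by rewrite ltr0n; apply/card_gt0P; exists [ffun=> [ffun=> 1%g]].
rewrite ler_pdivrMl//.
rewrite (eq_bigr (fun q => \int[Q]_om (\1_(S q) om : R))) => [|q _]; last by rewrite mean_indic.
have bS q := bounded_variable_indic R (mSq q).
rewrite -mean_sum// -[leRHS](mean_cst Q); apply: mean_le.
- exact: bounded_variable_sum.
- exact: bounded_variable_cst.
move=> om; pose T (rho : perms) := dHSIC H (permute (x ^~ om) rho).
have T0 rho : 0 <= T rho by rewrite /T dHSICE.
apply: (@le_trans _ _ (\sum_(q : {ffun 'I_B -> perms}) T (q b) ^+ 2 / t ^+ 2)).
  apply: ler_sum => q _; rewrite indicE; case: (boolP (om \in S q)) => [/set_mem h|_].
    by rewrite ler_pdivlMr ?exprn_gt0// mul1r ler_pXn2r ?nnegrE ?T0// ltW.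
  by rewrite divr_ge0// sqr_ge0.
rewrite -mulr_suml mulrA ler_wpM2r ?invr_ge0 ?sqr_ge0//.
have -> : \sum_(q : {ffun 'I_B -> perms}) T (q b) ^+ 2
    = #|{: perms}|%:R ^+ B.-1 * \sum_rho T rho ^+ 2.
  rewrite (eq_bigr (fun q : {ffun 'I_B -> perms} =>
      \prod_(c < B) (if c == b then T (q c) ^+ 2 else 1))) => [|q _].
    rewrite -(bigA_distr_bigA (fun c rho => if c == b then T rho ^+ 2 else 1)).
    rewrite (bigD1 b)//= eqxx mulrC; congr (_ * _).
    rewrite (eq_bigr (fun=> #|{: perms}|%:R)) => [|c /negPf ->].
      by rewrite prodr_const cardC1 card_ord.
    by rewrite sumr_const.
  by rewrite (bigD1 b)//= eqxx big1 ?mulr1// => c /negPf ->.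
have B0 : (0 < B)%N by case: (B) (b) => [[]|].
rewrite [in leRHS]card_ffun card_ord natrX -[in leRHS](prednK B0) exprSr -mulrA.
rewrite ler_wpM2l ?exprn_ge0//.
exact: (sum_sqr_dHSIC_permute H k_bounds).
Qed.

(** Testing the witness in the single direction given by the section of the
    kernel at [y], where the product mean factorizes into one average per
    coordinate. *)
Lemma prob_observed_small (y : prod_space X) (c eta t : R) : (0 < n)%N ->
  c <= `|\int[P]_w tensor_kernel k w y - \prod_j \int[P]_w k j (w j) (y j)| ->
  0 < eta -> eta * (1 + (\prod_(j < d) (1 + K j)) * d%:R) <= c / 2 ->
  t * `|rkhs_section H y| < c / 2 ->
  fine (Q [set om | dHSIC H (x ^~ om) <= t])
    <= (K0 ^+ 2 + \sum_j K j ^+ 2) / eta ^+ 2 / n%:R.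
Proof.
move=> n0 hc eta0 hL ht.
set u := \int[P]_w tensor_kernel k w y in hc.
pose a j := \int[P]_w k j (w j) (y j).
set L := \prod_(j < d) (1 + K j) in hL.
pose U om := n%:R^-1 * \sum_(i < n) tensor_kernel k (x i om) y.
pose A j om := n%:R^-1 * \sum_(i < n) k j (x i om j) (y j).
have Kge0 j : 0 <= K j by exact: (bound_ge0 k_bounds).
have nn0 : 0 < n%:R :> R by rewrite ltr0n.
(* [None] stands for the joint mean, [Some j] for the factor of index [j]. *)
pose E (o : option 'I_d) : set Om :=
  if o is Some j then [set om | eta <= `|A j om - a j|] else [set om | eta <= `|U om - u|].
have mten : measurable_fun setT (fun w : prod_space X => tensor_kernel k w y).
  exact: (measurable_tensor_section X_separable k_continuous k_psd k_bounds).
have msec j : measurable_fun setT (fun w : prod_space X => k j (w j) (y j)).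
  exact: (measurable_section X_separable k_continuous k_psd k_bounds).
have mE o : measurable (E o).
  case: o => [j|]; apply: measurable_ge_set; apply: measurableT_comp => //;
    apply: measurable_funB => //; apply: measurable_funM => //;
    apply: measurable_sum => i.
  - exact: (measurableT_comp (msec j)).
  - exact: (measurableT_comp mten).
have ten_bounds w : 0 <= tensor_kernel k w y <= K0.
  rewrite /tensor_kernel prodr_ge0 => [|j _]; last exact: (kernel_ge0 k_bounds).
  by apply: ler_prod => j _; exact: k_bounds.
have mSm : measurable [set om | dHSIC H (x ^~ om) <= t].
  rewrite -[X in measurable X]setTI.
  apply: (@measurable_fun_le _ _ R setT _ (cst t)) => //.
  rewrite (_ : (fun om => _) = (fun om => dHSIC H (permute (x ^~ om) [ffun=> 1%g]))).
    exact: measurable_dHSIC_sample.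
  by apply/funext => om; rewrite permute_identity.
apply: (@le_trans _ _ (\sum_(o : option 'I_d) fine (Q (E o)))).
  apply: prob_le_sum => // om /= small.
  rewrite leNgt; apply/negP => lt1.
  have none o : ~ E o om.
    move=> Eo; move: lt1; rewrite (bigD1 o)//= indicE mem_set//= ltNge lerDl.
    by rewrite sumr_ge0// => o' _; rewrite indicE ler0n.
  have hU : `|U om - u| < eta by rewrite ltNge; apply/negP; exact: (none None).
  have hA j : `|A j om - a j| < eta by rewrite ltNge; apply/negP; exact: (none (Some j)).
  have avg_bounds j : 0 <= A j om <= K j.
    rewrite /A mulr_ge0 ?invr_ge0 ?sumr_ge0//= => [|i _]; last exact: (kernel_ge0 k_bounds).
    rewrite ler_pdivrMl// mulr_natl -[X in _ *+ X](card_ord n) -sumr_const.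
    by apply: ler_sum => i _; exact: (kernel_leK k_bounds).
  have mean_bounds j : 0 <= a j <= K j.
    have bk : bounded_variable (fun w : prod_space X => k j (w j) (y j)).
      split => //; exists (K j) => w; rewrite ger0_norm; first exact: (kernel_leK k_bounds).
      exact: (kernel_ge0 k_bounds).
    rewrite /a Rintegral_ge0//= => [|w _]; last exact: (kernel_ge0 k_bounds).
    rewrite -[leRHS](mean_cst P); apply: mean_le => //; first exact: bounded_variable_cst.
    by move=> w; exact: (kernel_leK k_bounds).
  have VE : witness_value (x ^~ om) (rkhs_section H y) = U om - \prod_j A j om.
    rewrite /witness_value; congr (_ * _ - _).
      by apply: eq_bigr => i _; rewrite rkhs_sectionE.
    rewrite /A big_split /= prodr_const card_ord exprVn; congr (_ * _).
    rewrite bigA_distr_bigA; apply: eq_bigr => s _; exact: rkhs_sectionE.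
  have hprod : `|\prod_j A j om - \prod_j a j| <= L * (d%:R * eta).
    apply: le_trans (prod_difference_le avg_bounds mean_bounds) _.
    rewrite ler_wpM2l ?prodr_ge0// => [j _|]; first by rewrite addr_ge0.
    rewrite mulr_natl -[X in _ *+ X](card_ord d) -sumr_const.
    by apply: ler_sum => j _; exact: ltW.
  have upper : `|U om - \prod_j A j om| <= t * `|rkhs_section H y|.
    rewrite -VE witness_valueE mulrC.
    apply: le_trans (ler_wpM2l (normr_ge0 _) small); rewrite dHSICE ler_norml.
    rewrite dot_le_norm andbT lerNl -dotNl; apply: le_trans (dot_le_norm _ _) _.
    by rewrite normrN.
  have := ler_normD (u - U om) (U om - \prod_j A j om).
  have := ler_normD (u - \prod_j A j om) (\prod_j A j om - \prod_j a j).
  have hU' : `|u - U om| < eta by rewrite distrC.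
  rewrite !subrKA => h1 h2.
  have hL' : eta + L * (d%:R * eta) <= c / 2.
    by apply: le_trans hL; rewrite le_eqVlt; apply/orP; left; apply/eqP; ring.
  move: hc; rewrite -/(\prod_j a j); lra.
rewrite -mulrA -invfM [eta ^+ 2 * _]mulrC mulrDl mulr_suml.
rewrite (bigD1 None)//= lerD//.
  rewrite -lee_fin fineK; last exact: fin_num_measure (mE None).
  exact: (sample_average_deviation e).
rewrite (reindex_omap (@Some 'I_d) id) => [|[]//].
rewrite (eq_bigl xpredT) => [|j]; last by rewrite /= eqxx.
apply: ler_sum => j _; rewrite -lee_fin fineK; last exact: fin_num_measure (mE (Some j)).
exact: (sample_average_deviation e n0 eta0 (msec j) (fun w => k_bounds (w j) (y j))).
Qed.

End consistency_bounds.

(** * Consistency *)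

Section type_two_error.
Context (R : realType) (d : nat) (X : 'I_d -> ptopologicalType).
Context (X_separable : forall j, separable (X j)).
Context (k : forall j, X j -> X j -> R).
Arguments k : clear implicits.
Context (k_continuous : forall j, continuous (fun u : X j * X j => k j u.1 u.2))
  (k_psd : forall j, psd_kernel (k j))
  (K : 'I_d -> R) (k_bounds : forall j x y, 0 <= k j x y <= K j)
  (H : rkhs (tensor_kernel k)) (alpha eps del : R).
Context (P : probability (prod_space X) R)
  (dO : measure_display) (Om : measurableType dO) (Q : probability Om R)
  (n B : nat) (x : 'I_n -> {RV Q >-> prod_space X})
  (p : 'I_B -> Om -> {ffun 'I_d -> 'S_n}) (z : 'I_B.+1 -> {RV Q >-> R}).
Hypothesis e : dpdHSIC_experiment P x p z.
Local Notation perms := {ffun 'I_d -> 'S_n}.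
Local Notation scale := (2 * sensitivity K n * (privacy_level eps del)^-1).

Let stat om := noisy_statistic H K eps del (x ^~ om) (p ^~ om) (z ^~ om).

Let exceeds (b : 'I_B) : set Om := [set om | stat om ord0 <= stat om (lift ord0 b)].

Let measurable_exceeds b : measurable (exceeds b).
Proof.
pose A (q : {ffun 'I_B -> perms}) (u : 'I_n -> prod_space X) (v : 'I_B.+1 -> R) : Prop :=
  indexed_statistic K H eps del (with_identity q) u v ord0
    <= indexed_statistic K H eps del (with_identity q) u v (lift ord0 b).
have mA q : data_event (A q).
  move=> dT T u v mu mv; rewrite -[X in measurable X]setTI.
  by apply: (@measurable_fun_le _ _ R setT) => //;
    exact: (measurable_indexed_statistic X_separable k_continuous k_psd k_bounds H eps del).
have [+ _] := prob_average_perms e mA.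
suff -> : [set om | A [ffun b0 => p b0 om] (x ^~ om) (z ^~ om)] = exceeds b by [].
apply/funext => om; rewrite /mkset /A /exceeds /stat.
suff -> : [ffun b0 => p b0 om] = (p ^~ om) :> ('I_B -> perms) by [].
by apply/funext => b0; rewrite ffunE.
Qed.

Let noise_large (b : 'I_B.+1) (t : R) : set Om := [set om | t <= scale * `|z b om|].

Let prob_noise_large b t m : 0 <= scale -> scale * m < t ->
  measurable (noise_large b t) /\
  fine (Q (noise_large b t)) <= fine (laplace_prob [set v : R | m <= `|v|]).
Proof.
move=> s0 sm.
have mN : measurable (noise_large b t).
  apply: measurable_ge_set; apply: measurable_funM => //.
  by apply: measurableT_comp => //.
have mL : measurable [set v : R | m <= `|v|].
  by apply: measurable_ge_set; exact: normr_measurable.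
split => //; rewrite -(noise_law e b mL) /distribution /pushforward.
have mzL : measurable (z b @^-1` [set v : R | m <= `|v|]).
  by rewrite -[X in measurable X]setTI; exact: measurable_funP.
rewrite -lee_fin !fineK ?fin_num_measure//.
apply: le_measure; rewrite ?inE// => om tl.
rewrite /preimage /mkset leNgt; apply/negP => lm.
by move: tl; rewrite /noise_large /mkset leNgt => /negP; apply; apply: le_lt_trans sm; rewrite ler_wpM2l// ltW.
Qed.

(** A p-value above [alpha] needs more than [alpha * (B + 1) - 1] exceedances,
    and Markov's inequality bounds that probability whatever the dependence
    between them; an exceedance needs a small observed statistic, a large
    permuted one or a large noise. *)
Lemma type_two_error_bound (t m r1 r2 : R) : (2 <= n)%N -> 0 < t ->
  0 <= scale -> scale * m < t ->
  fine (Q [set om | dHSIC H (x ^~ om) <= 4 * t]) <= r1 ->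
  fine (laplace_prob [set v : R | m <= `|v|]) <= r2 ->
  (alpha * B.+1%:R - 1) *
    fine (Q (~` [set om | dpdHSIC_test H K alpha eps del (x ^~ om) (p ^~ om) (z ^~ om)]))
  <= B%:R * (r1 + permuted_second_moment_bound K n / t ^+ 2 + 2 * r2).
Proof.
move=> n2 t0 s0 sm hr1 hr2.
set S := [set om | _].
have [mS _] := expected_testE X_separable k_continuous k_psd k_bounds H alpha eps del e.
have mSC : measurable (~` S) by exact: measurableC.
pose E b (i : 'I_4) : set Om := nth set0
  [:: [set om | dHSIC H (x ^~ om) <= 4 * t];
      [set om | t <= dHSIC H (permute (x ^~ om) (p b om))];
      noise_large ord0 t; noise_large (lift ord0 b) t] i.
have mT : measurable [set om | dHSIC H (x ^~ om) <= 4 * t].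
  rewrite -[X in measurable X]setTI.
  apply: (@measurable_fun_le _ _ R setT _ (cst (4 * t))) => //.
  rewrite (_ : (fun om => _) = (fun om => dHSIC H (permute (x ^~ om) [ffun=> 1%g]))).
    exact: (measurable_dHSIC_sample X_separable k_continuous k_psd k_bounds).
  by apply/funext => om; rewrite permute_identity.
have pb b : fine (Q (exceeds b)) <= r1 + permuted_second_moment_bound K n / t ^+ 2 + 2 * r2.
  have [mp hp] := prob_permuted_large X_separable k_continuous k_psd k_bounds H e b n2 t0.
  have [mn0 hn0] := prob_noise_large ord0 s0 sm.
  have [mn1 hn1] := prob_noise_large (lift ord0 b) s0 sm.
  have mE i : measurable (E b i) by case: i => [[|[|[|[|]]]]].
  apply: (@le_trans _ _ (\sum_(i < 4) fine (Q (E b i)))).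
    apply: prob_le_sum => // om /= ex.
    rewrite leNgt; apply/negP => lt1.
    have none i : ~ E b i om.
      move=> Ei; move: lt1; rewrite (bigD1 i)//= indicE mem_set//= ltNge lerDl.
      by rewrite sumr_ge0// => i' _; rewrite indicE ler0n.
    have /negP := none (@Ordinal 4 0 isT); rewrite /E /= -ltNge => h0.
    have /negP := none (@Ordinal 4 1 isT); rewrite /E /= -ltNge => h1.
    have /negP := none (@Ordinal 4 2 isT); rewrite /E /= -ltNge => h2.
    have /negP := none (@Ordinal 4 3 isT); rewrite /E /= -ltNge => h3.
    move: ex; rewrite /exceeds /stat /noisy_statistic /with_identity unlift_none liftK /= permute_identity.
    have := ler_norm (- z ord0 om); rewrite normrN => g0.
    have g1 := ler_norm (z (lift ord0 b) om).
    have f0 := ler_wpM2l s0 g0; have f1 := ler_wpM2l s0 g1.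
    move: f0 f1 h2 h3; rewrite mulrN; lra.
  rewrite !big_ord_recl big_ord0 /E /=; lra.
have bE b := bounded_variable_indic R (measurable_exceeds b).
have bS := bounded_variable_indic R mSC.
apply: (@le_trans _ _ (\sum_(b < B) fine (Q (exceeds b)))); last first.
  by rewrite mulr_natl -[X in _ *+ X](card_ord B) -sumr_const; exact: ler_sum.
rewrite -(mean_indic Q mSC) (eq_bigr (fun b => \int[Q]_om (\1_(exceeds b) om : R))) => [|b _]; last first.
  by rewrite mean_indic.
rewrite -mean_sum// -RintegralZl//; last exact: bounded_variable_integrable.
apply: mean_le.
- exact: bounded_variableM (bounded_variable_cst Om _) bS.
- exact: bounded_variable_sum.
move=> om; rewrite [in leLHS]indicE; case: (boolP (om \in ~` S)) => [/set_mem|_]; last first.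
  by rewrite mulr0 sumr_ge0// => b _; rewrite indicE ler0n.
rewrite mulr1 /S /= => /negP; rewrite /dpdHSIC_test /dp_pvalue -ltNge.
rewrite mulrC ltr_pdivlMr ?ltr0n// => /ltW; rewrite -lerBlDr.
move/le_trans; apply; apply: ler_sum => b _; rewrite indicE ler_nat.
case: (leP (noisy_statistic _ _ _ _ _ _ _ ord0) _) => // ex.
by rewrite mem_set.
Qed.

End type_two_error.

Section limits.
Context (R : realType).

Lemma permuted_second_moment_bound_cvg0 (d : nat) (K : 'I_d -> R) :
  permuted_second_moment_bound K n @[n --> \oo] --> (0 : R).
Proof.
have h0 : @harmonic R n @[n --> \oo] --> (0 : R) by exact: cvg_harmonic.
have h1 : @harmonic R n.+1 @[n --> \oo] --> (0 : R).
  by have := h0; rewrite -[X in X -> _](cvg_shiftS (@harmonic R)).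
have base : 1 + @harmonic R n @[n --> \oo] --> (1 + 0 : R).
  by apply: cvgD => //; exact: cvg_cst.
have pow i : (1 + @harmonic R n) ^+ i @[n --> \oo] --> ((1 + 0) ^+ i : R).
  elim: i => [|i IH]; first exact: cvg_cst.
  by rewrite exprS; under eq_fun do rewrite exprS; exact: cvgM.
have shifted : \prod_(j < d) K j * (harmonic n.+1 + ((1 + harmonic n) ^+ d - 1))
    @[n --> \oo] --> (0 : R).
  rewrite -(mulr0 (\prod_(j < d) K j)); apply: cvgM; first exact: cvg_cst.
  have -> : (0 : R) = 0 + ((1 + 0) ^+ d - 1) by rewrite add0r addr0 expr1n subrr.
  by apply: cvgD h1 _; apply: cvgB (pow d) _; exact: cvg_cst.
rewrite -(cvg_shiftn 2) (_ : [sequence _]_n = (fun n => \prod_(j < d) K j *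
    (harmonic n.+1 + ((1 + harmonic n) ^+ d - 1))))//.
apply/funext => n /=; rewrite /permuted_second_moment_bound addn2 /=.
congr (_ * (_ + (_ ^+ _ - _))).
by rewrite -(natr1 n.+1) mulrDl mulfV ?pnatr_eq0// mul1r.
Qed.

(** The bound is stated for the Laplace law itself, so that it serves for the
    noise variables of all sample sizes; it follows from continuity from above
    of the law of any of them. *)
Lemma laplace_tail (dO : measure_display) (Om : measurableType dO)
    (Q : probability Om R) (z : {RV Q >-> R}) (r : R) : standard_laplace z -> 0 < r ->
  exists m : R, fine (laplace_prob [set v : R | m <= `|v|]) <= r.
Proof.
move=> lap r0; pose T m : set R := [set v : R | m%:R <= `|v|].
have mT m : measurable (T m).
  by apply: (measurable_ge_set (f := fun v : R => `|v|)); exact: normr_measurable.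
have cap : \bigcap_m T m = set0.
  apply/seteqP; split => // v /= h.
  have := h (Num.truncn `|v|).+1 I; rewrite /T /= leNgt => /negP; apply.
  exact: truncnS_gt.
have : distribution Q z (T m) @[m --> \oo] --> distribution Q z (\bigcap_m T m).
  apply: nonincreasing_cvg_mu => //.
  - by apply: le_lt_trans (probability_le1 _ _) (ltry _).
  - by rewrite cap.
  - move=> a b ab; apply/subsetPset => v; rewrite /T /=; apply: le_trans.
    by rewrite ler_nat.
rewrite cap measure0 => /fine_cvgP[_] /cvgrPdist_le /(_ r r0)[N _ /(_ N (leqnn N))].
rewrite /= sub0r normrN => hN; exists N%:R.
rewrite -(lap _ (mT N)); apply: le_trans hN; exact: ler_norm.
Qed.

(** The ratio decreases in [B], so its largest value is at the least admissible
    number of permutations. *)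
Lemma permutations_ratio_bounded (alpha : R) (B : nat -> nat) : 0 < alpha < 1 ->
  (forall n, (0 < n)%N -> alpha^-1 - 1 < (B n)%:R) ->
  exists2 C : R, 0 <= C & forall n, (0 < n)%N ->
    0 < alpha * (B n).+1%:R - 1 /\ (B n)%:R <= C * (alpha * (B n).+1%:R - 1).
Proof.
move=> /andP[a0 a1] hB.
have gain m : alpha^-1 - 1 < m%:R -> 0 < alpha * m.+1%:R - 1.
  by rewrite ltrBlDr natr1 -[alpha^-1]mul1r ltr_pdivrMr// mulrC subr_gt0.
have ex : exists m : nat, alpha^-1 - 1 < m%:R by exists (B 1%N); exact: hB.
have [m hm mmin] := ex_minnP ex.
have gm := gain _ hm; exists (m%:R / (alpha * m.+1%:R - 1)); first by rewrite divr_ge0// ltW.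
move=> n n0; have hn := hB n n0; split; first exact: gain.
rewrite mulrAC ler_pdivlMr//.
have mB : m%:R <= (B n)%:R :> R by rewrite ler_nat; exact: mmin.
rewrite -!natr1.
have : m%:R * (1 - alpha) <= (B n)%:R * (1 - alpha) by rewrite ler_wpM2r// subr_ge0 ltW.
lra.
Qed.

End limits.

Section consistency.
Context (R : realType) (d : nat) (d_ge2 : (2 <= d)%N) (X : 'I_d -> ptopologicalType).
Context (X_separable : forall j, separable (X j)).
Context (k : forall j, X j -> X j -> R).
Arguments k : clear implicits.
Context (k_continuous : forall j, continuous (fun u : X j * X j => k j u.1 u.2))
  (k_psd : forall j, psd_kernel (k j))
  (K : 'I_d -> R) (k_bounds : forall j x y, 0 <= k j x y <= K j)
  (H : rkhs (tensor_kernel k)).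
Context (k_characteristic :
     characteristic_kernel (tensor_kernel k : prod_space X -> prod_space X -> R)).
Context (alpha : R) (alpha01 : 0 < alpha < 1).
Context (eps del : nat -> R) (B : nat -> nat)
  (levels : forall n, (0 < n)%N -> 0 < eps n /\ 0 <= del n < 1)
  (level_cvg : n%:R^-1 * (privacy_level (eps n) (del n))^-1 @[n --> \oo] --> 0)
  (B_large : forall n, (0 < n)%N -> alpha^-1 - 1 < (B n)%:R).
Context (P : probability (prod_space X) R) (P_alt : ~ product_of_marginals P)
  (dO : nat -> measure_display) (Om : forall n, measurableType (dO n))
  (Q : forall n, probability (Om n) R)
  (x : forall n, 'I_n -> {RV (Q n) >-> prod_space X})
  (p : forall n, 'I_(B n) -> Om n -> {ffun 'I_d -> 'S_n})
  (z : forall n, 'I_(B n).+1 -> {RV (Q n) >-> R}).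
Arguments x : clear implicits.
Arguments p : clear implicits.
Arguments z : clear implicits.
Context (e : forall n, (0 < n)%N -> dpdHSIC_experiment P (x n) (p n) (z n)).

Let accepts n : set (Om n) := ~` [set om | dpdHSIC_test H K alpha (eps n) (del n)
  (fun i => x n i om) (fun b => p n b om) (fun b => z n b om)].

Arguments accepts : clear implicits.

Let scale n : R := 2 * sensitivity K n * (privacy_level (eps n) (del n))^-1.

Let scale_ge0 n : (0 < n)%N -> 0 <= scale n.
Proof.
move=> n0; have [e0 d01] := levels n0.
rewrite /scale mulr_ge0 ?invr_ge0 ?(ltW (privacy_level_gt0 _ _))//.
by rewrite mulr_ge0// /sensitivity !mulr_ge0 ?invr_ge0 ?sqrtr_ge0.
Qed.

Let scale_cvg0 : scale n @[n --> \oo] --> (0 : R).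
Proof.
pose c := 2 * (2 * d%:R * Num.sqrt (\prod_(j < d) K j)).
rewrite -(mulr0 c).
rewrite (_ : scale = (fun n => c * (n%:R^-1 * (privacy_level (eps n) (del n))^-1))).
  by apply: cvgM => //; exact: cvg_cst.
by apply/funext => n; rewrite /scale /sensitivity /c !mulrA.
Qed.

Let type_two_error_cvg0 : fine (Q n (accepts n)) @[n --> \oo] --> (0 : R).
Proof.
have d0 : (0 < d)%N by exact: leq_trans d_ge2.
have [y sep] := alternative_separated X_separable k_continuous k_psd k_bounds
  k_characteristic (e d0) P_alt.
set c := `|\int[P]_w tensor_kernel k w y - \prod_j \int[P]_w k j (w j) (y j)|.
have c0 : 0 < c by rewrite normr_gt0 subr_eq0.
pose L := 1 + (\prod_(j < d) (1 + K j)) * d%:R.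
have L0 : 0 < L.
  rewrite ltr_wpDr// mulr_ge0// prodr_ge0// => j _.
  by rewrite addr_ge0// (bound_ge0 k_bounds).
pose eta := c / 2 / L.
have eta0 : 0 < eta by rewrite !divr_gt0.
pose s := `|rkhs_section H y|.
have s0 : 0 <= s by exact: normr_ge0.
have s1 : 0 < 1 + s by rewrite ltr_wpDr.
(* With this threshold, a statistic at most [4 * t] would leave less than [c / 2]
   for the separation seen through the witness. *)
pose t := c / (16 * (1 + s)).
have t0 : 0 < t by rewrite divr_gt0// mulr_gt0.
have ts : 4 * t * s < c / 2.
  have tE : 16 * (1 + s) * t = c by rewrite /t mulrCA mulfV ?mulr1// gt_eqF// mulr_gt0.
  have := mulr_ge0 (ltW t0) s0; move: tE; rewrite mulrDr mulrDl => tE ts0; lra.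
have etaL : eta * L <= c / 2 by rewrite /eta divfK// gt_eqF.
pose D := (\prod_(j < d) K j) ^+ 2 + \sum_j K j ^+ 2.
have D0 : 0 <= D by rewrite addr_ge0 ?sqr_ge0// sumr_ge0// => j _; exact: sqr_ge0.
have [C C0 hC] := permutations_ratio_bounded alpha01 B_large.
apply/cvgr0Pnorm_le => r r0.
(* Four terms of size [r'] contribute, each multiplied by at most [C]. *)
pose r' := r / (4 * (C + 1)).
have r'0 : 0 < r' by rewrite divr_gt0// mulr_gt0// ltr_wpDl.
have [m hm] := laplace_tail (noise_law (e (ltn0Sn 0)) ord0) r'0.
have hD : D / eta ^+ 2 / n%:R @[n --> \oo] --> (0 : R).
  rewrite -(mulr0 (D / eta ^+ 2)); apply: cvgM; first exact: cvg_cst.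
  by rewrite -cvg_shiftS; exact: cvg_harmonic.
have hP : permuted_second_moment_bound K n / t ^+ 2 @[n --> \oo] --> (0 : R).
  rewrite -(mul0r (t ^+ 2)^-1); apply: cvgM; last exact: cvg_cst.
  exact: permuted_second_moment_bound_cvg0.
have hs : scale n * m @[n --> \oo] --> (0 : R).
  by rewrite -(mul0r m); apply: cvgM => //; exact: cvg_cst.
near=> n.
have n2 : (2 <= n)%N by near: n; exact: nbhs_infty_ge.
have n0 : (0 < n)%N by exact: leq_trans n2.
have sm : scale n * m < t.
  apply: le_lt_trans (ler_norm _) _; near: n.
  by have /cvgr0Pnorm_lt := hs; exact.
have h1 : D / eta ^+ 2 / n%:R <= r'.
  apply: le_trans (ler_norm _) _; near: n.
  by have /cvgr0Pnorm_le := hD; exact.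
have h2 : permuted_second_moment_bound K n / t ^+ 2 <= r'.
  apply: le_trans (ler_norm _) _; near: n.
  by have /cvgr0Pnorm_le := hP; exact.
have small := prob_observed_small X_separable k_continuous k_psd k_bounds (e n0)
  n0 (lexx c) eta0 etaL ts.
have := type_two_error_bound X_separable k_continuous k_psd k_bounds
  alpha (e n0) n2 t0 (scale_ge0 n0) sm
  (le_trans small h1) hm.
have [gain ratio] := hC n n0.
set q := fine _; rewrite -/(accepts n) => hq.
have q0 : 0 <= q by rewrite fine_ge0.
rewrite ger0_norm//.
have rE : r' * (4 * (C + 1)) = r by rewrite /r' divfK// gt_eqF// mulr_gt0// ltr_wpDl.
set G := alpha * _ - 1 in gain ratio hq.
have Bn0 : 0 <= (B n)%:R :> R by [].
have h4 : (B n)%:R * (r' + permuted_second_moment_bound K n / t ^+ 2 + 2 * r')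
   <= C * G * (4 * r').
  apply: (@le_trans _ _ ((B n)%:R * (4 * r'))); first by rewrite ler_wpM2l//; lra.
  by rewrite ler_wpM2r// mulr_ge0// ltW.
rewrite -(ler_pM2l gain); apply: le_trans hq _; apply: le_trans h4 _.
rewrite (_ : G * r = C * G * (4 * r') + 4 * (G * r')); last by rewrite -rE; ring.
by rewrite lerDl mulr_ge0// ltW// mulr_gt0.
Unshelve. all: by end_near.
Qed.

Lemma dpdHSIC_consistent :
  expected_test H K alpha (eps n) (del n) (x n) (p n) (z n) @[n --> \oo] --> 1%E.
Proof.
have lim1 : 1 - fine (Q n (accepts n)) @[n --> \oo] --> (1 - 0 : R).
  by apply: cvgB => //; exact: cvg_cst.
have : (1 - fine (Q n (accepts n)))%:E @[n --> \oo] --> (1 : R)%:E.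
  by rewrite subr0 in lim1; apply: cvg_EFin => //; near=> n.
apply: cvg_trans; apply: near_eq_cvg; near=> n.
have n0 : (0 < n)%N by near: n; exact: nbhs_infty_gt.
have [mS ->] := expected_testE X_separable k_continuous k_psd k_bounds H alpha
  (eps n) (del n) (e n0).
have mA : measurable (accepts n) by exact: measurableC.
rewrite /accepts EFinB fineK ?fin_num_measure//.
rewrite probability_setC// oppeB ?fin_num_measure// addeA subee// add0e.
by [].
Unshelve. all: by end_near.
Qed.

End consistency.

(** * The three guarantees *)

Theorem theorem3p1 (R : realType) (d : nat) (d_ge2 : (2 <= d)%N)
  (X : 'I_d -> ptopologicalType) (X_separable : forall j, separable (X j))
  (k : forall j, X j -> X j -> R)
  (k_continuous : forall j, continuous (fun u : X j * X j => k j u.1 u.2))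
  (k_psd : forall j, psd_kernel (k j))
  (K : 'I_d -> R) (k_bounds : forall j x y, 0 <= k j x y <= K j)
  (H : rkhs (tensor_kernel k))
  (k_characteristic :
     characteristic_kernel (tensor_kernel k : prod_space X -> prod_space X -> R))
  (alpha : R) (alpha01 : 0 < alpha < 1) :
  [/\ (* privacy *)
      forall (n B : nat) (eps del : R),
        (0 < n)%N -> (0 < B)%N -> 0 < eps -> 0 <= del < 1 ->
        forall (dO : measure_display) (Om : measurableType dO)
          (Q : probability Om R) (z : 'I_B.+1 -> {RV Q >-> R}),
          iid_laplace z ->
          differentially_private eps del Q
            (fun (x : 'I_n -> prod_space X)
                 (p : 'I_B -> {ffun 'I_d -> 'S_n}) (om : Om) =>
               dpdHSIC_test H K alpha eps del x p (z ^~ om)),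
      (* validity *)
      forall (n B : nat) (eps del : R),
        (0 < n)%N -> (0 < B)%N -> 0 < eps -> 0 <= del < 1 ->
        forall P : probability (prod_space X) R, product_of_marginals P ->
        forall (dO : measure_display) (Om : measurableType dO)
          (Q : probability Om R) (x : 'I_n -> {RV Q >-> prod_space X})
          (p : 'I_B -> Om -> {ffun 'I_d -> 'S_n})
          (z : 'I_B.+1 -> {RV Q >-> R}),
          dpdHSIC_experiment P x p z ->
          (expected_test H K alpha eps del x p z <= alpha%:E)%E
    & (* pointwise consistency *)
      forall (eps del : nat -> R) (B : nat -> nat),
        (forall n, (0 < n)%N -> 0 < eps n /\ 0 <= del n < 1) ->
        n%:R^-1 * (privacy_level (eps n) (del n))^-1 @[n --> \oo] --> 0 ->
        (forall n, (0 < n)%N -> alpha^-1 - 1 < (B n)%:R) ->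
        forall P : probability (prod_space X) R, ~ product_of_marginals P ->
        forall (dO : nat -> measure_display)
          (Om : forall n, measurableType (dO n))
          (Q : forall n, probability (Om n) R)
          (x : forall n, 'I_n -> {RV (Q n) >-> prod_space X})
          (p : forall n, 'I_(B n) -> Om n -> {ffun 'I_d -> 'S_n})
          (z : forall n, 'I_(B n).+1 -> {RV (Q n) >-> R}),
          (forall n, (0 < n)%N ->
             dpdHSIC_experiment P (x n) (p n) (z n)) ->
          expected_test H K alpha (eps n) (del n) (x n) (p n) (z n)
            @[n --> \oo] --> 1%E ].
Proof.
have /andP[alpha0 _] := alpha01.
split.
- move=> n B eps del _ _ eps0 del01 dO Om Q z z_iid.
  exact: dpdHSIC_private.
- move=> n B eps del _ _ _ _ P P_null dO Om Q x p z e.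
  exact: (dpdHSIC_valid X_separable k_continuous k_psd k_bounds H eps del
    (ltW alpha0) e P_null).
move=> eps del B levels level_cvg B_large P P_alt dO Om Q x p z e.
exact: (dpdHSIC_consistent d_ge2 X_separable k_continuous k_psd k_bounds H
  k_characteristic alpha01 levels level_cvg B_large P_alt e).
Qed.
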